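(* Let $G=\mathrm{SL}(3,\mathbb{C})$ and let $\mathfrak{X}=(G\times G)/\!\!/G$ be the categorical quotient of $G\times G$ by simultaneous conjugation. A completely reducible representation in $\mathfrak{X}$ is singular if and only if its orbit has positive-dimensional isotropy. That is, for $\rho=(A_1,A_2)\in G\times G$ a completely reducible representation of the free group $F_2$, the point $[\rho]\in\mathfrak{X}$ is a singular point of $\mathfrak{X}$ if and only if the stabilizer of $\rho$ in $G$ under conjugation has positive dimension; and the singular locus $\mathfrak{J}$ of $\mathfrak{X}$ is $$\mathfrak{J}=\mathrm{SL}_3(\mathrm{GL}(2,\mathbb{C}))^{\times 2}/\!\!/G .$$
   Context: $G=\mathrm{SL}(3,\mathbb{C})$ acts on $G\times G\cong \mathrm{Hom}(F_2,G)$ by simultaneous conjugation, where $F_2$ is the free group of rank $2$ and a homomorphism is identified with the pair of images of the two free generators. $\mathfrak{X}=(G\times G)/\!\!/G$ is the affine variety whose coordinate ring is the invariant ring $\mathbb{C}[G\times G]^G$, and $\pi:G\times G\to\mathfrak{X}$, $\rho\mapsto[\rho]$, is the quotient map. A representation $\rho:F_2\to G$ is completely reducible if $\mathbb{C}^3$ is a direct sum of irreducible $\rho(F_2)$-invariant subspaces; every point of $\mathfrak{X}$ is $[\rho]$ for a completely reducible $\rho$, unique up to conjugation. $\mathrm{SL}_3(\mathrm{GL}(2,\mathbb{C}))$ is the subgroup of $G$ of matrices $\begin{pmatrix} a&b&0\\ c&d&0\\ 0&0&\frac{1}{ad-bc}\end{pmatrix}$ with $ad-bc\neq0$. For an algebraic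 subgroup $H\subset G$, $H^{\times 2}/\!\!/G$ denotes the image $\pi(H\times H)\subset\mathfrak{X}$. $\mathfrak{X}$ is isomorphic to a hypersurface in $\mathbb{C}^9$ whose ideal is generated by a single polynomial $f=t_{(5)}^2-Pt_{(5)}+Q$, with $P,Q$ polynomials in eight variables $t_{(\pm1)},\dots,t_{(\pm4)}$, the coordinates being the nine trace functions $t_{(1)}=\mathrm{tr}(\mathbf{x}_1)$, $t_{(-1)}=\mathrm{tr}(\mathbf{x}_1^{-1})$, $t_{(2)}=\mathrm{tr}(\mathbf{x}_2)$, $t_{(-2)}=\mathrm{tr}(\mathbf{x}_2^{-1})$, $t_{(3)}=\mathrm{tr}(\mathbf{x}_1\mathbf{x}_2)$, $t_{(-3)}=\mathrm{tr}(\mathbf{x}_1^{-1}\mathbf{x}_2^{-1})$, $t_{(4)}=\mathrm{tr}(\mathbf{x}_1\mathbf{x}_2^{-1})$, $t_{(-4)}=\mathrm{tr}(\mathbf{x}_1^{-1}\mathbf{x}_2)$, $t_{(5)}=\mathrm{tr}(\mathbf{x}_1\mathbf{x}_2\mathbf{x}_1^{-1}\mathbf{x}_2^{-1})$. The singular locus $\mathfrak{J}\subset\mathfrak{X}$ is the closed subset where all nine partial derivatives of $f$ vanish (the usual singular locus of the affine variety $\mathfrak{X}$). *)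

(* Defs.v *)
From HB Require Import structures.
From mathcomp Require Import all_boot all_order all_algebra.
From mathcomp Require Import complex mpoly.
From mathcomp Require Import boolp classical_sets reals.

Set Implicit Arguments.
Unset Strict Implicit.
Unset Printing Implicit Defensive.

Import Order.TTheory GRing.Theory Num.Theory.

Local Open Scope classical_set_scope.
Local Open Scope ring_scope.

Section Zariski.
Variables (K : fieldType) (n : nat).
Implicit Types Z S : set 'rV[K]_n.

Definition zariski_closed Z : Prop :=
  exists I : set {mpoly K[n]}, Z = [set v | forall p, I p -> p.@[v 0] = 0].

Definition irreducible_closed Z : Prop :=
  [/\ zariski_closed Z, Z !=set0 &
      forall Z1 Z2, zariski_closed Z1 -> zariski_closed Z2 ->
        Z `<=` Z1 `|` Z2 -> Z `<=` Z1 \/ Z `<=` Z2].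

(* [dim_ge S d]: the closed set [S] has Krull dimension at least [d], i.e.
   there is a chain Z_0 < Z_1 < ... < Z_d of irreducible closed subsets. *)
Definition dim_ge S (d : nat) : Prop :=
  exists Z : nat -> set 'rV[K]_n,
    (forall i, (i <= d)%N -> irreducible_closed (Z i) /\ Z i `<=` S) /\
    (forall i, (i < d)%N -> Z i `<` Z i.+1).

Definition positive_dimensional S : Prop := dim_ge S 1.

End Zariski.

Section CharacterVariety.
Variable K : fieldType.

Notation M3 := 'M[K]_3.

Definition SL3 : set M3 := [set A | \det A = 1].

(* [rho = (A1, A2)] is the representation of the free group F_2 sending the
   two free generators to [A1] and [A2]. *)
Definition HomF2 : set (M3 * M3) := SL3 `*` SL3.

Definition conj2 (g : M3) (rho : M3 * M3) : M3 * M3 :=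
  (g *m rho.1 *m invmx g, g *m rho.2 *m invmx g).

Definition stabilizer (rho : M3 * M3) : set M3 :=
  [set g | SL3 g /\ conj2 g rho = rho].

Definition invariant_subspace (rho : M3 * M3) (U : {vspace 'cV[K]_3}) : Prop :=
  forall v, v \in U ->
    [/\ rho.1 *m v \in U, invmx rho.1 *m v \in U,
        rho.2 *m v \in U & invmx rho.2 *m v \in U].

Definition irreducible_subspace (rho : M3 * M3) (U : {vspace 'cV[K]_3}) : Prop :=
  [/\ invariant_subspace rho U, U <> 0%VS &
      forall W : {vspace 'cV[K]_3}, invariant_subspace rho W ->
        (W <= U)%VS -> W = 0%VS \/ W = U].

Definition completely_reducible (rho : M3 * M3) : Prop :=
  exists (n : nat) (U : 'I_n -> {vspace 'cV[K]_3}),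
    [/\ forall i, irreducible_subspace rho (U i),
        directv (\sum_(i < n) U i)%VS &
        (\sum_(i < n) U i)%VS = fullv].

(* Since G x G is closed in the space of pairs of matrices, every regular
   function on it is the restriction of a polynomial in the 18 entries. *)
Definition eval2 (p : {mpoly K[3 * 3 + 3 * 3]}) (rho : M3 * M3) : K :=
  p.@[row_mx (mxvec rho.1) (mxvec rho.2) 0].

Definition conj_invariant (p : {mpoly K[3 * 3 + 3 * 3]}) : Prop :=
  forall g rho, SL3 g -> HomF2 rho -> eval2 p (conj2 g rho) = eval2 p rho.

(* A point of the categorical quotient X is an evaluation homomorphism
   K[G x G]^G -> K; an invariant function is given by any polynomial
   restricting to it. *)
Definition git_point : Type := {p | conj_invariant p} -> K.

Definition git_pi (rho : M3 * M3) : git_point := fun p => eval2 (sval p) rho.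

(* The image in X of H x H, for a subgroup H of G. *)
Definition git_image (H : set M3) : set git_point := git_pi @` (H `*` H).

Definition SL3_GL2 : set M3 :=
  (fun A : 'M[K]_2 => block_mx A 0 0 ((\det A)^-1)%:M : 'M[K]_(2 + 1)) @`
    [set A | \det A != 0].

(* The coordinates, in the order
   t(1), t(-1), t(2), t(-2), t(3), t(-3), t(4), t(-4), t(5). *)
Definition trace_coords (rho : M3 * M3) (i : 'I_9) : K :=
  let: (x, y) := rho in
  let x' := invmx x in
  let y' := invmx y in
  tnth [tuple \tr x; \tr x'; \tr y; \tr y'; \tr (x *m y); \tr (x' *m y');
              \tr (x *m y'); \tr (x' *m y); \tr (x *m y *m x' *m y')] i.

Definition hypersurface_eqn (P Q : {mpoly K[8]}) : {mpoly K[9]} :=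
  'X_ord_max ^+ 2 - mwiden P * 'X_ord_max + mwiden Q.

Definition generates_ideal_of_X (f : {mpoly K[9]}) : Prop :=
  forall g : {mpoly K[9]},
    (forall rho, HomF2 rho -> g.@[trace_coords rho] = 0) <->
    (exists h, g = h * f).

(* Trace coordinates depend only on the point [git_pi rho], see
   [trace_coords_git_pi] below. *)
Definition singular_locus : set git_point :=
  git_pi @` [set rho | HomF2 rho /\
    exists P Q : {mpoly K[8]},
      let f := hypersurface_eqn P Q in
      generates_ideal_of_X f /\
      forall i : 'I_9, (f^`M(i)).@[trace_coords rho] = 0].

Let gen1 : 'M[{mpoly K[3 * 3 + 3 * 3]}]_3 :=
  \matrix_(i, j) 'X_(lshift (3 * 3) (mxvec_index i j)).
Let gen2 : 'M[{mpoly K[3 * 3 + 3 * 3]}]_3 :=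
  \matrix_(i, j) 'X_(rshift (3 * 3) (mxvec_index i j)).

Let trace_words (L : comNzRingType) (x y : 'M[L]_3) (x' y' : 'M[L]_3) :=
  [tuple \tr x; \tr x'; \tr y; \tr y'; \tr (x *m y); \tr (x' *m y');
         \tr (x *m y'); \tr (x' *m y); \tr (x *m y *m x' *m y')].

Let trace_words_morph (L L' : comNzRingType) (h : {rmorphism L -> L'})
    (x y : 'M[L]_3) i :
  h (tnth (trace_words x y (\adj x) (\adj y)) i) =
  tnth (trace_words (map_mx h x) (map_mx h y)
         (\adj (map_mx h x)) (\adj (map_mx h y))) i.
Proof.
rewrite -(tnth_map h); congr (tnth _ i); apply: val_inj.
by rewrite /= -!map_mx_adj -!map_mxM !trace_map_mx.
Qed.

Let trace_poly (i : 'I_9) : {mpoly K[3 * 3 + 3 * 3]} :=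
  tnth (trace_words gen1 gen2 (\adj gen1) (\adj gen2)) i.

Let SL3_unit (A : M3) : SL3 A -> A \in unitmx.
Proof. by move=> dA; rewrite unitmxE dA unitr1. Qed.

Let adj_SL3 (A : M3) : SL3 A -> \adj A = invmx A.
Proof. by move=> dA; rewrite /invmx (SL3_unit dA) dA invr1 scale1r. Qed.

Let eval_trace_poly i rho : HomF2 rho ->
  eval2 (trace_poly i) rho = trace_coords rho i.
Proof.
case: rho => x y [] /= dx dy; rewrite /eval2 /=.
set v := (X in meval X); pose h : {rmorphism _ -> _} := meval v.
have E1 : map_mx h gen1 = x.
  by apply/matrixP=> k l; rewrite !mxE /= mevalXU /v row_mxEl mxvecE.
have E2 : map_mx h gen2 = y.
  by apply/matrixP=> k l; rewrite !mxE /= mevalXU /v row_mxEr mxvecE.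
rewrite /trace_poly /trace_coords -(adj_SL3 dx) -(adj_SL3 dy).
by rewrite -E1 -E2 -trace_words_morph.
Qed.

Let trace_coords_conj g rho : SL3 g -> HomF2 rho ->
  trace_coords (conj2 g rho) = trace_coords rho.
Proof.
case: rho => x y /SL3_unit ug [] /= /SL3_unit ux /SL3_unit uy.
have Ei (A : M3) : A \in unitmx ->
  invmx (g *m A *m invmx g) = g *m invmx A *m invmx g.
  move=> uA; have uB : g *m A *m invmx g \in unitmx.
    by rewrite !unitmx_mul ug uA unitmx_inv.
  apply: (can_inj (mulKmx uB)); rewrite mulmxV //.
  by rewrite !mulmxA mulmxKV // mulmxK // mulmxV.
have EM (A B : M3) :
  g *m A *m invmx g *m (g *m B *m invmx g) = g *m (A *m B) *m invmx g.
  by rewrite !mulmxA mulmxKV.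
have ET (A : M3) : \tr (g *m A *m invmx g) = \tr A.
  by rewrite mxtrace_mulC mulKmx.
apply: funext => i; rewrite /trace_coords /conj2 /= !Ei // !EM !ET.
by [].
Qed.

Lemma trace_coords_git_pi rho rho' : HomF2 rho -> HomF2 rho' ->
  git_pi rho = git_pi rho' -> trace_coords rho = trace_coords rho'.
Proof.
move=> h h' e; apply: funext => i; rewrite -!eval_trace_poly //.
have inv : conj_invariant (trace_poly i).
  move=> g r dg hr; rewrite !eval_trace_poly ?trace_coords_conj //.
  case: r hr => x y [] /= dx dy.
  by split; rewrite /SL3 /= !det_mulmx det_inv dg invr1 mulr1 mul1r.
by have := congr1 (@^~ (exist _ _ inv)) e.
Qed.

End CharacterVariety.

(* Main.v *)
Require Import Defs.
From HB Require Import structures.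
From mathcomp Require Import all_boot all_order all_algebra.
From mathcomp Require Import spectral ring.
From mathcomp Require Import complex mpoly.
From mathcomp Require Import boolp classical_sets reals.

Set Implicit Arguments.
Unset Strict Implicit.
Unset Printing Implicit Defensive.

Import Order.TTheory GRing.Theory Num.Theory.

Local Open Scope classical_set_scope.
Local Open Scope ring_scope.

(** The trace functions t(5)(x, y) = tr [x, y] and tr [y, x] are the two roots
    of f over the eight other traces, so f is t(5)^2 - P t(5) + Q with P and Q
    their sum and product, and 4 f = u^2 - (P^2 - 4 Q) with
    u = 2 t(5) - P = tr [x, y] - tr [y, x] = det (xy - yx).

    At a pair in SL_3(GL_2) all partial derivatives of f vanish by inspection,
    and a representation with a common eigenvector (or eigencovector) has the
    same image in the quotient as its block diagonal part, by a one-parameter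
    limit.

    Conversely let (x, y) be irreducible with all partial derivatives of f
    zero.  Then det (xy - yx) = 0, and this is exactly what makes the six linear
    equations "B, xB, yB are symmetric" in the six entries of B dependent.
    Irreducibility makes B invertible, so transposition followed by conjugation
    by B fixes (x, y); it preserves the eight traces and exchanges the two roots
    t(5).  Along a line through (x, y) in a direction reversed by this
    involution the eight traces are even functions of the parameter z whereas u
    is odd, and the z^2-coefficient of f is the square of the z-coefficient of
    t(5).  As it must vanish, u has zero derivative in all those directions, and
    this forces the vector representing the skew matrix (xy - yx)B to be a
    common eigenvector of x and y. *)

(** * Polynomials *)

Section MPolyFacts.
Variables (n : nat) (K : fieldType).
Implicit Types p : {mpoly K[n]}.

(** Constants and variables generate the polynomial ring; morphism identities are checked below on
    these alone, without handling monomials. *)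
Lemma mpoly_ring_ind (A : {mpoly K[n]} -> Prop) :
  (forall c, A c%:MP) -> (forall i, A 'X_i) ->
  (forall p q, A p -> A q -> A (p + q)) ->
  (forall p q, A p -> A q -> A (p * q)) -> forall p, A p.
Proof.
move=> hC hX hD hM; elim/mpolyind=> [|c m p _ _ Ap]; first exact: hC.
apply: (hD) => //; rewrite -mul_mpolyC; apply: (hM) => //.
rewrite mpolyXE_id; elim/big_ind: _ => [||i _]; [exact: hC | exact: (hM) |].
by elim: (m i) => [|k IH]; [exact: hC | rewrite exprS; exact: hM].
Qed.

Lemma meval_curve p (q : 'I_n -> {poly K}) z :
  p.@[fun i => (q i).[z]] = (mmap polyC q p).[z].
Proof.
elim/mpoly_ring_ind: p => [c|i|p p' IH IH'|p p' IH IH'].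
- by rewrite mevalC mmapC hornerC.
- by rewrite mevalXU mmapX mmap1U.
- by rewrite mevalD rmorphD hornerD IH IH'.
- by rewrite mevalM rmorphM hornerM IH IH'.
Qed.

(** First-order Taylor expansion along the curve [a + X^k r], with remainder divisible by [X^(2k)].
    The case k = 1 serves for lines, k = 2 for curves without linear term. *)
Lemma mmap_taylor1 p (a : 'I_n -> K) (r : 'I_n -> {poly K}) k :
  exists w, mmap polyC (fun i => (a i)%:P + 'X^k * r i) p =
    (p.@[a])%:P + 'X^k * (\sum_i (p^`M(i)).@[a] *: r i) + 'X^(k + k) * w.
Proof.
elim/mpoly_ring_ind: p => [c|i|p p' [w Hw] [w' Hw']|p p' [w Hw] [w' Hw']].
- exists 0; rewrite mevalC mmapC mulr0 addr0 big1 ?mulr0 ?addr0 // => i _.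
  by rewrite mderivC meval0 scale0r.
- exists 0; rewrite mevalXU mmapX mmap1U mulr0 addr0; congr (_ + _ * _).
  rewrite (bigD1 i) //= mderivX mnmE eqxx scale1r.
  rewrite (_ : U_(i) - U_(i) = 0)%MM; last by apply/mnmP=> j; rewrite !mnmE subnn.
  rewrite mpolyX0 meval1 scale1r big1 ?addr0 // => j ji.
  by rewrite mderivX mnmE eq_sym (negbTE ji) scale0r meval0 scale0r.
- exists (w + w'); rewrite rmorphD /= Hw Hw' mevalD polyCD mulrDr.
  under [in RHS]eq_bigr do rewrite mderivD mevalD scalerDl.
  rewrite big_split /= mulrDr; ring.
- set d := \sum_i _ in Hw; set d' := \sum_i _ in Hw'.
  exists (d * d' + (p.@[a])%:P * w' + (p'.@[a])%:P * w
          + 'X^k * d * w' + 'X^k * w * d' + 'X^k * 'X^k * w * w').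
  rewrite rmorphM /= Hw Hw' mevalM polyCM.
  have -> : \sum_i ((p * p')^`M(i)).@[a] *: r i = (p'.@[a]) *: d + (p.@[a]) *: d'.
    rewrite !scaler_sumr -big_split; apply: eq_bigr => i _ /=.
    by rewrite mderivM mevalD !mevalM scalerDl !scalerA [_ * p'.@[a]]mulrC.
  rewrite -!mul_polyC exprD; ring.
Qed.

End MPolyFacts.

Lemma mmap_mwiden (K : fieldType) n (L : comNzRingType) (f : {rmorphism K -> L})
    (q : 'I_n.+1 -> L) (p : {mpoly K[n]}) :
  mmap f q (mwiden p) = mmap f (fun i => q (widen_ord (leqnSn n) i)) p.
Proof.
elim/mpoly_ring_ind: p => [c|i|p p' IH IH'|p p' IH IH'].
- by rewrite mwidenC !mmapC.
- by rewrite mwidenX mnmwiden1 !mmapX !mmap1U.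
- by rewrite mwidenD !rmorphD /= IH IH'.
- by rewrite mwidenM !rmorphM /= IH IH'.
Qed.

Lemma meval_mwiden (K : fieldType) n (v : 'I_n.+1 -> K) (p : {mpoly K[n]}) :
  (mwiden p).@[v] = p.@[fun i => v (widen_ord (leqnSn n) i)].
Proof. exact: (mmap_mwiden idfun). Qed.

Lemma mderiv_mwiden (K : fieldType) n (p : {mpoly K[n]}) i :
  (mwiden p)^`M(widen_ord (leqnSn n) i) = mwiden (p^`M(i)).
Proof.
elim/mpoly_ring_ind: p => [c|j|p p' IH IH'|p p' IH IH'].
- by rewrite mwidenC !mderivC mwiden0.
- rewrite mwidenX mnmwiden1 !mderivX mwidenZ mwidenX; congr (_%:R *: 'X_[_]).
    by rewrite !mnmE.
  apply/mnmP=> k; case: (unliftP ord_max k) => [l ->|->].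
    have -> : lift ord_max l = widen_ord (leqnSn n) l.
      by apply: val_inj; rewrite /= /bump leqNgt ltn_ord.
    by rewrite mnmwiden_widen !mnmE.
  rewrite mnmwiden_ordmax !mnmE.
  by rewrite -!val_eqE /= (ltn_eqF (ltn_ord i)) (ltn_eqF (ltn_ord j)).
- by rewrite mwidenD !mderivD mwidenD IH IH'.
- by rewrite mwidenM !mderivM mwidenD !mwidenM IH IH'.
Qed.

Lemma mderiv_mwiden_max (K : fieldType) n (p : {mpoly K[n]}) :
  (mwiden p)^`M(ord_max) = 0.
Proof.
elim/mpoly_ring_ind: p => [c|j|p p' IH IH'|p p' IH IH'].
- by rewrite mwidenC !mderivC.
- rewrite mwidenX mnmwiden1 mderivX mnmE -val_eqE /= (ltn_eqF (ltn_ord j)).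
  by rewrite scale0r.
- by rewrite mwidenD !mderivD IH IH' addr0.
- by rewrite mwidenM !mderivM IH IH' mulr0 mul0r addr0.
Qed.

(** * Polynomials vanishing at all points, in characteristic zero *)

Section NumPoly.
Variable K : numFieldType.

(** The product [q * r] vanishes everywhere, hence at more distinct natural numbers than its degree.
    The factor [r] lets finitely many parameters be left out. *)
Lemma poly0_of_horner (q r : {poly K}) : r != 0 ->
  (forall z, r.[z] != 0 -> q.[z] = 0) -> q = 0.
Proof.
move=> r0 qz; suff /eqP : q * r = 0 by rewrite mulf_eq0 (negbTE r0) orbF => /eqP.
apply/eqP/contraT => nz; set s := [seq i%:R : K | i <- iota 0 (size (q * r))].
have : (size s < size (q * r)%R)%N.
  apply: max_poly_roots => //.
    apply/allP=> z _; rewrite rootE hornerM.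
    by have [->|/qz->] := eqVneq r.[z] 0; rewrite ?mulr0 ?mul0r.
  by rewrite map_inj_uniq ?iota_uniq // => i j /eqP; rewrite eqr_nat => /eqP.
by rewrite size_map size_iota ltnn.
Qed.

(** Induction on the degree of the monomial: the partial derivatives vanish everywhere too, and in
    characteristic zero they determine every nonconstant coefficient. *)
Lemma mpoly0_of_meval n (p : {mpoly K[n]}) : (forall v, p.@[v] = 0) -> p = 0.
Proof.
move=> Zp; apply/mpolyP=> m; rewrite mcoeff0.
have [k] := ubnP (mdeg m); elim: k => // k IH in p Zp m *; rewrite ltnS => mk.
have [-> | [i mi]] : m = 0%MM \/ exists i, (0 < m i)%N.
- have [/existsP|] := boolP [exists i, (0 < m i)%N]; first by right.
  rewrite negb_exists => /forallP m0; left; apply/mnmP=> i; rewrite mnm0E.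
  by apply/eqP; rewrite -leqn0 leqNgt m0.
- rewrite -(Zp (fun=> 0)); elim/mpoly_ring_ind: {Zp}p => [c|i|p q IHp IHq|p q IHp IHq].
  + by rewrite mcoeffC eqxx mulr1 mevalC.
  + by rewrite mevalXU mcoeffX mnm1_eq0.
  + by rewrite mcoeffD mevalD IHp IHq.
  + by rewrite mevalM -IHp -IHq rmorphM.
pose m' := (m - U_(i))%MM.
have Em : m = (m' + U_(i))%MM.
  apply/mnmP=> j; rewrite mnmDE mnmBE mnm1E; case: eqP => [<-|_]; last by rewrite subn0 addn0.
  by rewrite subn1 addn1 prednK.
have /eqP : (p^`M(i))@_m' = 0.
  apply: IH; last by move: mk; rewrite Em mdegD mdeg1 addn1.
  (* The restriction of p to the line through v in direction i; its linear coefficient is the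
     partial derivative at v. *)
  move=> v; pose q := mmap polyC (fun j => (v j)%:P + 'X^1 * (j == i)%:R%:P) p.
  have q0 : q = 0.
    apply: (poly0_of_horner (r := 1)); first exact: oner_neq0.
    by move=> z _; rewrite /q -meval_curve Zp.
  have [w] := mmap_taylor1 p v (fun j => (j == i)%:R%:P) 1.
  rewrite -/q q0 => /(congr1 (coefp 1)); rewrite /= coef0 !coefD coefC.
  rewrite coefXM coefXnM /= addr0 add0r coef_sum (bigD1 i) //= eqxx coefZ coefC mulr1.
  by rewrite big1 ?addr0 // => j /negbTE ->; rewrite coefZ coefC mulr0.
by rewrite mcoeff_mderiv -Em mulrn_eq0 /= => /eqP.
Qed.

Lemma even_coef1 (q : {poly K}) : (forall z, q.[z] = q.[- z]) -> q`_1 = 0.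
Proof.
move=> ev; have /(congr1 (coefp 1)) /= : q - (q \Po (- 'X)) = 0.
  apply: (poly0_of_horner (r := 1)); first exact: oner_neq0.
  by move=> z _; rewrite hornerD hornerN horner_comp hornerN hornerX -ev subrr.
rewrite coefD coefN coef0.
have -> : (q \Po - 'X)`_1 = - q`_1.
  elim/poly_ind: q {ev} => [|q c IH]; first by rewrite comp_poly0 coef0 oppr0.
  rewrite comp_poly_MXaddC !coefD !coefC /= !addr0 mulrN coefN !coefMX /=.
  congr (- _); rewrite -!horner_coef0 horner_comp hornerN hornerX oppr0 //.
by move/eqP; rewrite opprK -mulr2n mulrn_eq0 /= => /eqP.
Qed.

End NumPoly.

(** * Three by three matrices *)

Notation o0 := (@Ordinal 3 0 isT).
Notation o1 := (@Ordinal 3 1 isT).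
Notation o2 := (@Ordinal 3 2 isT).

Lemma ord3P (A : 'I_3 -> Prop) : A o0 -> A o1 -> A o2 -> forall i, A i.
Proof.
move=> A0 A1 A2 [[|[|[|//]]] lt_i].
- by rewrite (_ : Ordinal _ = o0) //; apply: val_inj.
- by rewrite (_ : Ordinal _ = o1) //; apply: val_inj.
- by rewrite (_ : Ordinal _ = o2) //; apply: val_inj.
Qed.

Lemma sum3 (V : nmodType) (F : 'I_3 -> V) : \sum_i F i = F o0 + F o1 + F o2.
Proof.
rewrite !big_ord_recl big_ord0 addr0 addrA.
by congr (F _ + F _ + F _); apply: val_inj.
Qed.

Definition mx3 (L : nmodType) (a b c d e f g h i : L) : 'M[L]_3 :=
  \matrix_(k, l) nth 0 (nth [::] [:: [:: a; b; c]; [:: d; e; f]; [:: g; h; i]] k) l.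

Lemma mx3E (L : nmodType) (A : 'M[L]_3) :
  A = mx3 (A o0 o0) (A o0 o1) (A o0 o2) (A o1 o0) (A o1 o1) (A o1 o2)
          (A o2 o0) (A o2 o1) (A o2 o2).
Proof. by apply/matrixP; elim/ord3P; elim/ord3P; rewrite mxE. Qed.

Lemma mx3P (L : nmodType) (A B : 'M[L]_3) :
  A o0 o0 = B o0 o0 -> A o0 o1 = B o0 o1 -> A o0 o2 = B o0 o2 ->
  A o1 o0 = B o1 o0 -> A o1 o1 = B o1 o1 -> A o1 o2 = B o1 o2 ->
  A o2 o0 = B o2 o0 -> A o2 o1 = B o2 o1 -> A o2 o2 = B o2 o2 -> A = B.
Proof. by move=> *; rewrite (mx3E A) (mx3E B); congr mx3. Qed.

Lemma lift3E : (lift o0 (0 : 'I_2) = o1) * (lift o0 (1 : 'I_2) = o2) *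
   (lift o1 (0 : 'I_2) = o0) * (lift o1 (1 : 'I_2) = o2) *
   (lift o2 (0 : 'I_2) = o0) * (lift o2 (1 : 'I_2) = o1).
Proof. by do !split; apply: val_inj. Qed.

Section Det3.
Variable L : comNzRingType.
Implicit Types A B : 'M[L]_3.

Lemma det2 (A : 'M[L]_2) : \det A = A 0 0 * A 1 1 - A 0 1 * A 1 0.
Proof.
rewrite (expand_det_row _ 0) big_ord_recl big_ord1 /cofactor !det_mx11 !mxE /=.
rewrite /bump /= !expr0 !expr1 mul1r mulN1r mulrN.
by congr (A _ _ * A _ _ - A _ _ * A _ _); apply: val_inj.
Qed.

Lemma det3 A : \det A =
  A o0 o0 * (A o1 o1 * A o2 o2 - A o1 o2 * A o2 o1)
  - A o0 o1 * (A o1 o0 * A o2 o2 - A o1 o2 * A o2 o0)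
  + A o0 o2 * (A o1 o0 * A o2 o1 - A o1 o1 * A o2 o0).
Proof.
rewrite (expand_det_row _ o0) sum3 /cofactor !det2 !mxE !lift3E /=; ring.
Qed.

Variables a b c d e f g h i : L.
Local Notation A := (mx3 a b c d e f g h i).

Lemma det_mx3 : \det A =
  a * (e * i - f * h) + b * (f * g - d * i) + c * (d * h - e * g).
Proof. by rewrite det3 !mxE /=; ring. Qed.

Lemma adj_mx3 : \adj A = mx3
    (e * i - f * h) (h * c - i * b) (b * f - c * e)
    (f * g - d * i) (i * a - g * c) (c * d - a * f)
    (d * h - e * g) (g * b - h * a) (a * e - b * d).
Proof. by apply: mx3P; rewrite !mxE /cofactor det2 !mxE !lift3E /=; ring. Qed.

Lemma trace_mx3 : \tr A = a + e + i.
Proof. by rewrite /mxtrace sum3 !mxE. Qed.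

Lemma tr_mx3 : A^T = mx3 a d g b e h c f i.
Proof. by apply: mx3P; rewrite !mxE. Qed.

Lemma mul_mx3 (a' b' c' d' e' f' g' h' i' : L) : A *m mx3 a' b' c' d' e' f' g' h' i' = mx3
    (a * a' + b * d' + c * g') (a * b' + b * e' + c * h') (a * c' + b * f' + c * i')
    (d * a' + e * d' + f * g') (d * b' + e * e' + f * h') (d * c' + e * f' + f * i')
    (g * a' + h * d' + i * g') (g * b' + h * e' + i * h') (g * c' + h * f' + i * i').
Proof. by apply: mx3P; rewrite !mxE sum3 !mxE. Qed.

Lemma add_mx3 (a' b' c' d' e' f' g' h' i' : L) : A + mx3 a' b' c' d' e' f' g' h' i' = mx3
  (a + a') (b + b') (c + c') (d + d') (e + e') (f + f') (g + g') (h + h') (i + i').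
Proof. by apply: mx3P; rewrite !mxE. Qed.

Lemma opp_mx3 : - A = mx3 (- a) (- b) (- c) (- d) (- e) (- f) (- g) (- h) (- i).
Proof. by apply: mx3P; rewrite !mxE. Qed.

Lemma scale_mx3 (k : L) : k *: A =
  mx3 (k * a) (k * b) (k * c) (k * d) (k * e) (k * f) (k * g) (k * h) (k * i).
Proof. by apply: mx3P; rewrite !mxE. Qed.

Lemma scalar_mx3 (k : L) : k%:M = mx3 k 0 0 0 k 0 0 0 k.
Proof. by apply: mx3P; rewrite !mxE. Qed.

End Det3.

(** * The equation of the character variety *)

(** Reified polynomials: one expression can be evaluated in any commutative ring, transported along
    morphisms and differentiated by computation. *)
Inductive texp :=
  | TVar of nat | TNat of nat | TExp of texp & nat
  | TAdd of texp & texp | TSub of texp & texp | TMul of texp & texp.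

Declare Scope texp_scope.
Delimit Scope texp_scope with E.
Bind Scope texp_scope with texp.
Notation "x + y" := (TAdd x y) : texp_scope.
Notation "x - y" := (TSub x y) : texp_scope.
Notation "x * y" := (TMul x y) : texp_scope.
Notation "x ^+ n" := (TExp x n) : texp_scope.
Notation "n %:R" := (TNat n) : texp_scope.

(* Variables without a value in [s] are read as [1]. *)
Fixpoint teval (L : comNzRingType) (s : seq L) (p : texp) : L :=
  match p with
  | TVar i => nth 1 s i
  | TNat n => n%:R
  | TExp p n => teval s p ^+ n
  | TAdd p q => teval s p + teval s q
  | TSub p q => teval s p - teval s q
  | TMul p q => teval s p * teval s q
  end.

Fixpoint tderiv (i : nat) (p : texp) : texp :=
  match p with
  | TVar j => TNat (i == j)
  | TNat _ => TNat 0
  | TExp p n => (n%:R * p ^+ n.-1 * tderiv i p)%E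
  | TAdd p q => (tderiv i p + tderiv i q)%E
  | TSub p q => (tderiv i p - tderiv i q)%E
  | TMul p q => (tderiv i p * q + p * tderiv i q)%E
  end.

Lemma teval_morph (L L' : comNzRingType) (h : {rmorphism L -> L'}) s p :
  h (teval s p) = teval (map h s) p.
Proof.
elim: p => [i|n|p IH n|p IHp q IHq|p IHp q IHq|p IHp q IHq] /=.
- have [lt|le] := ltnP i (size s); first by rewrite (nth_map 1).
  by rewrite !nth_default ?size_map // rmorph1.
- exact: rmorph_nat.
- by rewrite rmorphXn IH.
- by rewrite rmorphD IHp IHq.
- by rewrite rmorphB IHp IHq.
- by rewrite rmorphM IHp IHq.
Qed.

Lemma mderiv_teval (K : fieldType) n (p : texp) (i : 'I_n) :
  let s : seq {mpoly K[n]} := [seq 'X_j | j <- enum 'I_n] in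
  (teval s p)^`M(i) = teval s (tderiv i p).
Proof.
move=> s; have d1 : (1 : {mpoly K[n]})^`M(i) = 0 by rewrite -mpolyC1 mderivC.
elim: p => [j|k|p IH k|p IHp q IHq|p IHp q IHq|p IHp q IHq] /=.
(* A variable beyond the list is read as the constant 1, and the symbolic derivative is also 0
   because i < n <= j. *)
- have [le|lt] := leqP n j.
    have -> : nth 1 s j = 1 by rewrite nth_default // size_map size_enum_ord.
    by rewrite (ltn_eqF (leq_trans (ltn_ord i) le)); exact: d1.
  have -> : nth 1 s j = 'X_(Ordinal lt).
    rewrite (nth_map (Ordinal lt)) ?size_enum_ord //.
    by congr 'X_[U_(_)]; apply: val_inj; rewrite /= nth_enum_ord.
  rewrite mderivX mnmE -val_eqE /= eq_sym.
  have [ij|_] := eqVneq (i : nat) j; last by rewrite scale0r.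
  rewrite scale1r (_ : U_(_) - _ = 0)%MM ?mpolyX0 //; apply/mnmP=> l.
  by rewrite !mnmE -!val_eqE /= ij subnn.
- by rewrite -[k%:R]/(1 *+ k) mderivMn d1 mul0rn.
- elim: k => [|k IHk]; first by rewrite expr0 d1 !mul0r.
  rewrite exprS mderivM IHk IH mulrSr /=.
  case: k {IHk} => [|k] /=; first by rewrite expr0; ring.
  by rewrite exprS; ring.
- by rewrite mderivD IHp IHq.
- by rewrite mderivB IHp IHq.
- by rewrite mderivM IHp IHq.
Qed.

(* [P] and [Q], with coefficients found by interpolation, made bihomogeneous by
   the determinants [e] and [f]: then [teval_Pexp] and [teval_Qexp] hold for two
   arbitrary matrices, with adjugates for inverses.  On a list of traces alone
   [e] and [f] are read as [1].  The variable [8] is reserved for t(5). *)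
Definition Pexp : texp :=
  let t1 := TVar 0 in let s1 := TVar 1 in let t2 := TVar 2 in
  let s2 := TVar 3 in let t3 := TVar 4 in let s3 := TVar 5 in
  let t4 := TVar 6 in let s4 := TVar 7 in
  let e := TVar 9 in let f := TVar 10 in
  (t4 * s4 + t3 * s3 + t2 * s2 * e - s1 * s2 * t3 - s1 * t2 * t4 - t1 * s2 *
   s4 - t1 * t2 * s3 + t1 * s1 * f + t1 * s1 * t2 * s2 - 3%:R * e * f)%E.

Definition Qexp : texp :=
  let t1 := TVar 0 in let s1 := TVar 1 in let t2 := TVar 2 in
  let s2 := TVar 3 in let t3 := TVar 4 in let s3 := TVar 5 in
  let t4 := TVar 6 in let s4 := TVar 7 in
  let e := TVar 9 in let f := TVar 10 in
  (9%:R * e ^+ 2 * f ^+ 2 + s4 ^+ 3 * f - 6%:R * t4 * s4 * e * f + t4 ^+ 3 *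
   e + s3 ^+ 3 - 6%:R * t3 * s3 * e * f + t3 * s3 * t4 * s4 + t3 ^+ 3 * e * f
   + s2 * s3 * s4 ^+ 2 - 3%:R * s2 * s3 * t4 * e + s2 * t3 ^+ 2 * t4 * e + s2
   ^+ 2 * t3 * s4 * e + s2 ^+ 3 * e ^+ 2 + t2 * s3 ^+ 2 * s4 - 3%:R * t2 * t3
   * s4 * e * f + t2 * t3 * t4 ^+ 2 * e - 6%:R * t2 * s2 * e ^+ 2 * f + t2 *
   s2 * t4 * s4 * e + t2 * s2 * t3 * s3 * e + t2 ^+ 2 * s3 * t4 * e + t2 ^+ 3
   * e ^+ 2 * f - 3%:R * s1 * s3 * s4 * f + s1 * s3 * t4 ^+ 2 + s1 * t3 ^+ 2
   * s4 * f - 2%:R * s1 * s2 * s3 ^+ 2 + 3%:R * s1 * s2 * t3 * e * f + s1 *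
   s2 ^+ 2 * t4 * e - 2%:R * s1 * t2 * s4 ^+ 2 * f + 3%:R * s1 * t2 * t4 * e
   * f - s1 * t2 * s2 * s3 * s4 - s1 * t2 * s2 ^+ 2 * t3 * e + s1 * t2 ^+ 2 *
   t3 * e * f - s1 * t2 ^+ 2 * s2 * t4 * e + s1 ^+ 2 * t3 * t4 * f + s1 ^+ 2
   * s2 * s4 * f + s1 ^+ 2 * s2 ^+ 2 * s3 + s1 ^+ 2 * t2 * s3 * f + s1 ^+ 2 *
   t2 ^+ 2 * s4 * f + s1 ^+ 3 * f ^+ 2 - s1 ^+ 3 * t2 * s2 * f + t1 * s3 ^+ 2
   * t4 + t1 * t3 * s4 ^+ 2 * f - 3%:R * t1 * t3 * t4 * e * f + 3%:R * t1 *
   s2 * s4 * e * f - 2%:R * t1 * s2 * t4 ^+ 2 * e + t1 * s2 ^+ 2 * s3 * e +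
   3%:R * t1 * t2 * s3 * e * f - 2%:R * t1 * t2 * t3 ^+ 2 * e * f - t1 * t2 *
   s2 * t3 * t4 * e - t1 * t2 * s2 ^+ 2 * s4 * e + t1 * t2 ^+ 2 * s4 * e * f
   - t1 * t2 ^+ 2 * s2 * s3 * e - 6%:R * t1 * s1 * e * f ^+ 2 + t1 * s1 * t4
   * s4 * f + t1 * s1 * t3 * s3 * f - t1 * s1 * s2 * s3 * t4 - t1 * s1 * s2
   ^+ 3 * e - t1 * s1 * t2 * t3 * s4 * f + t1 * s1 * t2 * s2 * e * f + t1 *
   s1 * t2 ^+ 2 * s2 ^+ 2 * e - t1 * s1 * t2 ^+ 3 * e * f - t1 * s1 ^+ 2 * s2
   * t3 * f - t1 * s1 ^+ 2 * t2 * t4 * f + t1 ^+ 2 * s3 * s4 * f + t1 ^+ 2 *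
   s2 * t3 * e * f + t1 ^+ 2 * s2 ^+ 2 * t4 * e + t1 ^+ 2 * t2 * t4 * e * f +
   t1 ^+ 2 * t2 ^+ 2 * t3 * e * f - t1 ^+ 2 * s1 * s2 * s4 * f - t1 ^+ 2 * s1
   * t2 * s3 * f + t1 ^+ 2 * s1 ^+ 2 * t2 * s2 * f + t1 ^+ 3 * e * f ^+ 2 -
   t1 ^+ 3 * t2 * s2 * e * f)%E.

(** The inverses are separate arguments so that adjugates, which exist over every commutative ring,
    can stand for them. *)
Definition twords (L : comNzRingType) (x y x' y' : 'M[L]_3) : 9.-tuple L :=
  [tuple \tr x; \tr x'; \tr y; \tr y'; \tr (x *m y); \tr (x' *m y');
         \tr (x *m y'); \tr (x' *m y); \tr (x *m y *m x' *m y')].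

(** * Sum and product of the two commutator traces *)

Section TraceIdentity.
Variables (L : comNzRingType) (x y : 'M[L]_3).
Let x' := \adj x.
Let y' := \adj y.
Let s := twords x y x' y' ++ [:: \det x; \det y].

Lemma teval_Pexp :
  teval s Pexp = \tr (x *m y *m x' *m y') + \tr (y *m x *m y' *m x').
Proof.
rewrite /s /twords /x' /y' (mx3E x) (mx3E y) !(adj_mx3, mul_mx3, trace_mx3, det_mx3) /=.
ring.
Qed.

Lemma teval_Qexp :
  teval s Qexp = \tr (x *m y *m x' *m y') * \tr (y *m x *m y' *m x').
Proof.
rewrite /s /twords /x' /y' (mx3E x) (mx3E y) !(adj_mx3, mul_mx3, trace_mx3, det_mx3) /=.
ring.
Qed.

End TraceIdentity.

#[global] Arguments trace_coords : simpl never.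

Notation widen8 := (widen_ord (leqnSn 8)).

Definition Fexp : texp := (TVar 8 ^+ 2 - Pexp * TVar 8 + Qexp)%E.

(** Neither expression contains the variable 8, and the variables 9 and 10 still lie beyond the end
    of the longer list. *)
Lemma teval_PQ_rcons (L : comNzRingType) (s : seq L) z : size s = 8 ->
  teval (rcons s z) Pexp = teval s Pexp /\ teval (rcons s z) Qexp = teval s Qexp.
Proof. by do 8![case: s => [//|? s]]; case: s. Qed.

(** Both sides are cubic in x and in y once adjugates replace inverses, so no determinant factor
    appears. *)
Lemma det_comm (L : comNzRingType) (x y : 'M[L]_3) :
  \det (x *m y - y *m x) =
  \tr (x *m y *m \adj x *m \adj y) - \tr (y *m x *m \adj y *m \adj x).
Proof.
rewrite (mx3E x) (mx3E y) !(adj_mx3, mul_mx3, trace_mx3, opp_mx3, add_mx3, det_mx3).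
ring.
Qed.

(** * The equation evaluated on trace coordinates *)

Section Hypersurface.
Variable K : fieldType.
Implicit Types x y : 'M[K]_3.

Definition mpvars n : seq {mpoly K[n]} := [seq 'X_j | j <- enum 'I_n].

Lemma size_mpvars n : size (mpvars n) = n.
Proof. by rewrite size_map size_enum_ord. Qed.

Definition Ppoly : {mpoly K[8]} := teval (mpvars 8) Pexp.
Definition Qpoly : {mpoly K[8]} := teval (mpvars 8) Qexp.

Lemma meval_teval n (v : 'I_n -> K) p :
  (teval (mpvars n) p).@[v] = teval [seq v j | j <- enum 'I_n] p.
Proof.
rewrite [LHS](teval_morph (meval v)); congr teval.
by rewrite -map_comp; apply: eq_map => j /=; rewrite mevalXU.
Qed.

Lemma mpvars9 : mpvars 9 = rcons [seq mwiden q | q <- mpvars 8] 'X_ord_max.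
Proof.
rewrite /mpvars enum_ordSr map_rcons -!map_comp; congr rcons.
by apply: eq_map => j /=; rewrite mwidenX mnmwiden1.
Qed.

Lemma hypersurface_PQ : hypersurface_eqn Ppoly Qpoly = teval (mpvars 9) Fexp.
Proof.
have [EP EQ] : teval (mpvars 9) Pexp = mwiden Ppoly /\
               teval (mpvars 9) Qexp = mwiden Qpoly.
  rewrite mpvars9 /Ppoly /Qpoly.
  have [|-> ->] := @teval_PQ_rcons _ [seq mwiden q | q <- mpvars 8] 'X_ord_max.
    by rewrite size_map size_mpvars.
  by split; symmetry; apply: (teval_morph (mwiden (n := 8) (R := K))).
have E8 : nth 1 (mpvars 9) 8 = 'X_ord_max.
  by rewrite mpvars9 nth_rcons size_map size_mpvars.
(* [Fexp] is opened by one level only, with [Pexp] and [Qexp] left folded. *)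
transitivity (nth 1 (mpvars 9) 8 ^+ 2 - teval (mpvars 9) Pexp * nth 1 (mpvars 9) 8
  + teval (mpvars 9) Qexp) => //.
by rewrite EP EQ E8.
Qed.

Lemma trace_coordsE x y : SL3 x -> SL3 y ->
  trace_coords (x, y) = tnth (twords x y (\adj x) (\adj y)).
Proof.
have E (A : 'M[K]_3) : SL3 A -> invmx A = \adj A.
  by move=> dA; rewrite /invmx unitmxE dA unitr1 invr1 scale1r.
by move=> /E Ex /E Ey; apply: funext => i; rewrite /trace_coords Ex Ey.
Qed.

Lemma Fexp_trace x y : SL3 x -> SL3 y ->
  let s := twords x y (\adj x) (\adj y) in
  teval s Pexp = \tr (x *m y *m \adj x *m \adj y) + \tr (y *m x *m \adj y *m \adj x)
  /\ teval s Fexp = 0.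
Proof.
move=> dx dy s.
have := teval_Pexp x y; have := teval_Qexp x y; rewrite -/s dx dy.
rewrite -[teval _ Qexp]/(teval s Qexp) -[teval _ Pexp]/(teval s Pexp) => EQ EP.
split=> //; rewrite -[LHS]/(nth 1 s 8 ^+ 2 - teval s Pexp * nth 1 s 8 + teval s Qexp).
by rewrite EP EQ /=; ring.
Qed.

Lemma map_trace_coords x y : SL3 x -> SL3 y ->
  [seq trace_coords (x, y) j | j <- enum 'I_9] = twords x y (\adj x) (\adj y).
Proof. by move=> dx dy; rewrite trace_coordsE // map_tnth_enum. Qed.

Lemma hypersurface_PQ_trace rho : HomF2 rho ->
  (hypersurface_eqn Ppoly Qpoly).@[trace_coords rho] = 0.
Proof.
case: rho => x y [dx dy]; rewrite hypersurface_PQ meval_teval map_trace_coords //.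
by have [_] := Fexp_trace dx dy.
Qed.

(** Transposition reverses words. Up to cyclic rotation this changes none of the first eight traces,
    but it turns tr [x, y] into tr [y, x]. *)
Lemma transpose_trace x y : SL3 x -> SL3 y ->
  [/\ HomF2 (x^T, y^T),
      forall i, trace_coords (x^T, y^T) (widen8 i) = trace_coords (x, y) (widen8 i)
    & trace_coords (x, y) ord_max - trace_coords (x^T, y^T) ord_max =
        \det (x *m y - y *m x)].
Proof.
move=> dx dy.
have dx' : SL3 x^T by rewrite /SL3 /= det_tr.
have dy' : SL3 y^T by rewrite /SL3 /= det_tr.
split=> //.
- move=> i; rewrite !trace_coordsE // -!trmx_adj.
  have trM (A B : 'M[K]_3) : \tr (A^T *m B^T) = \tr (A *m B).
    by rewrite -trmx_mul mxtrace_tr mxtrace_mulC.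
  by case: i; do 8![case=> [i|]; first by rewrite /tnth /= ?trM ?mxtrace_tr].
rewrite det_comm !trace_coordsE // -!trmx_adj /tnth /=; congr (_ - _).
by rewrite -!trmx_mul mxtrace_tr !mulmxA -(mulmxA (_ *m _) y) mxtrace_mulC !mulmxA.
Qed.

Lemma tr_comm_Ppoly x y : SL3 x -> SL3 y ->
  Ppoly.@[fun i => trace_coords (x, y) (widen8 i)] =
  trace_coords (x, y) ord_max + trace_coords (x^T, y^T) ord_max.
Proof.
move=> dx dy; have [_ _] := transpose_trace dx dy; rewrite det_comm.
move=> Eu; rewrite /Ppoly meval_teval.
have := map_trace_coords dx dy; rewrite enum_ordSr map_rcons -map_comp.
set s := map _ _ => Es; have szs : size s = 8 by rewrite size_map size_enum_ord.
have [EP _] := teval_PQ_rcons (trace_coords (x, y) ord_max) szs.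
rewrite -[LHS]EP Es; have [-> _] := Fexp_trace dx dy.
rewrite (_ : trace_coords (x^T, y^T) _ =
  trace_coords (x, y) ord_max - (trace_coords (x, y) ord_max
    - trace_coords (x^T, y^T) ord_max)); last by ring.
by rewrite Eu [in RHS]trace_coordsE // /tnth /=; ring.
Qed.

End Hypersurface.

(** * The first eight traces are algebraically independent *)

Section Density.
Variable K : numClosedFieldType.

Lemma quadratic_roots (s q : K) : exists c1 c2, c1 + c2 = s /\ c1 * c2 = q.
Proof.
pose r := sqrtC (s ^+ 2 - 4 * q); have r2 : r ^+ 2 = s ^+ 2 - 4 * q by exact: sqrtCK.
by exists ((s + r) / 2), ((s - r) / 2); split; field: r2.
Qed.

Lemma cubic_roots (t s : K) :
  exists a1 a2 a3, [/\ a1 + a2 + a3 = t, a2 * a3 + a1 * a3 + a1 * a2 = s & a1 * a2 * a3 = 1].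
Proof.
(* a1 is a root of X^3 - t X^2 + s X - 1; the other two roots have sum t - a1 and product s - a1 (t
   - a1). *)
have [a1] := @solve_monicpoly K 3 (fun i => nth 0 [:: 1; - s; t] i) isT.
rewrite sum3 /= => Ea; have [a2 [a3 [E2 E3]]] := quadratic_roots (t - a1) (s - a1 * (t - a1)).
exists a1, a2, a3; split; first by rewrite -addrA E2; ring.
  by rewrite E3 -addrA -mulrDr [a3 + a2]addrC E2; ring.
by rewrite -mulrA E3; ring: Ea.
Qed.

(** For x diagonal with entries a1, a2, a3 of product 1, these are the equations prescribing tr y,
    tr (x y) and tr (x^-1 y) in terms of the diagonal of y. *)
Lemma vandermonde_solve (a1 a2 a3 b1 b2 b3 : K) : a1 != a2 -> a1 != a3 -> a2 != a3 ->
  exists d1 d2 d3, [/\ d1 + d2 + d3 = b1, a1 * d1 + a2 * d2 + a3 * d3 = b2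
    & a2 * a3 * d1 + a1 * a3 * d2 + a1 * a2 * d3 = b3].
Proof.
move=> h12 h13 h23.
exists ((b3 + a1 * b2 - a1 * (a2 + a3) * b1) / ((a1 - a2) * (a1 - a3))),
       ((b3 + a2 * b2 - a2 * (a1 + a3) * b1) / ((a2 - a1) * (a2 - a3))),
       ((b3 + a3 * b2 - a3 * (a1 + a2) * b1) / ((a3 - a1) * (a3 - a2))).
have [h21 h31 h32] : [/\ a2 != a1, a3 != a1 & a3 != a2].
  by rewrite ![_ == a1]eq_sym [a3 == a2]eq_sym.
by split; field; rewrite !subr_eq0 h12 h13 h23 h21 h31 h32.
Qed.

(* The two 3-cycles [c1], [c2] of [y] are the roots of [z^2 - s z + p1 p2 p3],
   with [s] prescribed by [\det y = 1]. *)
Lemma SL3_diag_2cycles (d1 d2 d3 p1 p2 p3 : K) : exists y2 y3 y4 y6 y7 y8 : K,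
  [/\ y6 * y8 = p1, y3 * y7 = p2, y2 * y4 = p3 &
      SL3 (mx3 d1 y2 y3 y4 d2 y6 y7 y8 d3)].
Proof.
have [c1 [c2 [Es Ep]]] := quadratic_roots
  (1 - d1 * d2 * d3 + d1 * p1 + d2 * p2 + d3 * p3) (p1 * p2 * p3).
have nz c c' : c != 0 -> c + c' = c1 + c2 -> c * c' = c1 * c2 -> exists y2 y3 y4 y6 y7 y8 : K,
  [/\ y6 * y8 = p1, y3 * y7 = p2, y2 * y4 = p3 &
      SL3 (mx3 d1 y2 y3 y4 d2 y6 y7 y8 d3)].
  (* The 3-cycle y2 y6 y7 is c by construction, and the other one, y3 y8 y4, is then p1 p2 p3 / c =
     c'. *)
  move=> c0 Es' Ep'; exists 1, (p2 / c), p3, 1, c, p1; split; rewrite ?mul1r ?divfK //.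
  have Ec : p2 / c * p1 * p3 = c' by rewrite -[c'](mulKf c0) Ep' Ep; field.
  rewrite /SL3 /= det_mx3 [RHS](_ : 1 = (c + c') - (c1 + c2) + 1 :> K).
    by rewrite Es -Ec; field.
  by rewrite Es' subrr add0r.
have [c10|/nz] := eqVneq c1 0; last exact.
have [c20|/nz] := eqVneq c2 0; last by apply; rewrite // [LHS](addrC, mulrC) // mulrC.
(* If both 3-cycles must vanish, some p_i is 0; setting both entries of that 2-cycle to 0 kills the
   two 3-cycles at once. *)
move: Ep Es; rewrite c10 c20 addr0 mul0r => /esym/eqP; rewrite !mulf_eq0 -orbA => p0 Es.
case/or3P: p0 => /eqP p0; rewrite p0 in Es *.
- exists 1, 1, p3, 0, p2, 0; split; rewrite ?mul1r ?mul0r //.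
  by rewrite /SL3 /= det_mx3 -[RHS]subr0 [in RHS]Es; ring.
- exists 1, 0, p3, 1, 0, p1; split; rewrite ?mul1r ?mul0r //.
  by rewrite /SL3 /= det_mx3 -[RHS]subr0 [in RHS]Es; ring.
- exists 0, 1, 0, 1, p2, p1; split; rewrite ?mul1r ?mul0r //.
  by rewrite /SL3 /= det_mx3 -[RHS]subr0 [in RHS]Es; ring.
Qed.

(** The discriminant of X^3 - t X^2 + s X - 1, the characteristic polynomial of a matrix of
    determinant 1 with tr x = t and tr x^-1 = s. *)
Definition disc3 (L : comNzRingType) (t s : L) :=
  t ^+ 2 * s ^+ 2 - 4 * t ^+ 3 - 4 * s ^+ 3 + 18 * t * s - 27.

(** Take x diagonal with distinct eigenvalues. The remaining six traces then amount to the diagonals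
    of y and of y^-1, which can be prescribed freely. *)
Lemma trace_coords_onto (t : 'I_8 -> K) :
  disc3 (t (@Ordinal 8 0 isT)) (t (@Ordinal 8 1 isT)) != 0 ->
  exists x y, [/\ SL3 x, SL3 y & forall i, trace_coords (x, y) (widen8 i) = t i].
Proof.
have [a1 [a2 [a3 [Et Es Ee]]]] :=
  cubic_roots (t (@Ordinal 8 0 isT)) (t (@Ordinal 8 1 isT)).
rewrite -Et -Es; have -> : disc3 (a1 + a2 + a3) (a2 * a3 + a1 * a3 + a1 * a2) =
  ((a1 - a2) * (a1 - a3) * (a2 - a3)) ^+ 2.
  by rewrite /disc3; ring: Ee.
rewrite expf_eq0 /= !mulf_eq0 !subr_eq0 !negb_or -andbA => /and3P[h12 h13 h23].
have [d1 [d2 [d3 [D1 D2 D3]]]] := vandermonde_solve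
  (t (@Ordinal 8 2 isT)) (t (@Ordinal 8 4 isT)) (t (@Ordinal 8 7 isT)) h12 h13 h23.
have [m1 [m2 [m3 [M1 M2 M3]]]] := vandermonde_solve
  (t (@Ordinal 8 3 isT)) (t (@Ordinal 8 6 isT)) (t (@Ordinal 8 5 isT)) h12 h13 h23.
(* The diagonal entries m_i of y^-1 are principal 2 by 2 minors of y, so they fix the products of
   opposite off-diagonal entries. *)
have [y2 [y3 [y4 [y6 [y7 [y8 [P1 P2 P3 dy]]]]]]] :=
  SL3_diag_2cycles d1 d2 d3 (d2 * d3 - m1) (d1 * d3 - m2) (d1 * d2 - m3).
have dx : SL3 (mx3 a1 0 0 0 a2 0 0 0 a3).
  by rewrite /SL3 /= det_mx3; ring: Ee.
exists (mx3 a1 0 0 0 a2 0 0 0 a3), (mx3 d1 y2 y3 y4 d2 y6 y7 y8 d3).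
split=> [||i]; [exact: dx | exact: dy |].
have Em1 : m1 = d2 * d3 - y6 * y8 by rewrite P1; ring.
have Em2 : m2 = d1 * d3 - y3 * y7 by rewrite P2; ring.
have Em3 : m3 = d1 * d2 - y2 * y4 by rewrite P3; ring.
rewrite (trace_coordsE dx dy) /tnth.
case: i => [[|[|[|[|[|[|[|[|//]]]]]]]] hi]; rewrite /= !(adj_mx3, mul_mx3, trace_mx3).
- by rewrite (bool_irrelevance hi isT) -Et.
- by rewrite (bool_irrelevance hi isT) -Es; ring.
- by rewrite (bool_irrelevance hi isT) -D1.
- by rewrite (bool_irrelevance hi isT) -M1 Em1 Em2 Em3; ring.
- by rewrite (bool_irrelevance hi isT) -D2; ring.
- by rewrite (bool_irrelevance hi isT) -M3 Em1 Em2 Em3; ring.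
- by rewrite (bool_irrelevance hi isT) -M2 Em1 Em2 Em3; ring.
- by rewrite (bool_irrelevance hi isT) -D3; ring.
Qed.

(** Every point with nonzero discriminant is attained, so p times the discriminant vanishes
    everywhere, and the polynomial ring is a domain. *)
Lemma trace_coords_dense (p : {mpoly K[8]}) :
  (forall x y, SL3 x -> SL3 y ->
    p.@[fun i => trace_coords (x, y) (widen8 i)] = 0) -> p = 0.
Proof.
move=> p0; pose D : {mpoly K[8]} :=
  disc3 'X_(@Ordinal 8 0 isT) 'X_(@Ordinal 8 1 isT).
have ED v : D.@[v] = disc3 (v (@Ordinal 8 0 isT)) (v (@Ordinal 8 1 isT)).
  by rewrite /D /disc3 !(rmorph_nat, rmorphB, rmorphD, rmorphM, rmorphXn) /= !mevalXU.
have D0 : D != 0.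
  apply/eqP=> /(congr1 (meval (fun=> 0))); rewrite ED meval0 /disc3 => /eqP.
  rewrite (_ : _ - _ = - 27); first by rewrite oppr_eq0 pnatr_eq0.
  by ring.
have : p * D = 0.
  apply: mpoly0_of_meval => v; rewrite mevalM ED.
  have [->|/trace_coords_onto[x [y [dx dy Ev]]]] :=
    eqVneq (disc3 (v (@Ordinal 8 0 isT)) (v (@Ordinal 8 1 isT))) 0.
    by rewrite mulr0.
  by rewrite -(meval_eq _ Ev) p0 // mul0r.
by move/eqP; rewrite mulf_eq0 (negbTE D0) orbF => /eqP.
Qed.

End Density.

(** Division with remainder by f, which is monic of degree two in t(5). *)
Lemma hypersurface_divide (K : fieldType) (P Q : {mpoly K[8]}) (g : {mpoly K[9]}) :
  exists h A B, g = h * hypersurface_eqn P Q + mwiden A + mwiden B * 'X_ord_max.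
Proof.
rewrite /hypersurface_eqn.
elim/mpoly_ring_ind: g => [c|i|p q [h [A [B ->]]] [h' [A' [B' ->]]]|
    p q [h [A [B ->]]] [h' [A' [B' ->]]]].
- by exists 0, c%:MP, 0; rewrite mwidenC mwiden0; ring.
- case: (unliftP ord_max i) => [j ->|->].
    exists 0, 'X_j, 0; rewrite mwidenX mnmwiden1 mwiden0 (_ : widen_ord _ _ = lift ord_max j).
      by ring.
    by apply: val_inj; rewrite /= /bump leqNgt ltn_ord.
  by exists 0, 0, 1; rewrite mwiden0 mwiden1; ring.
- by exists (h + h'), (A + A'), (B + B'); rewrite !mwidenD; ring.
exists (h * (h' * ('X_ord_max ^+ 2 - mwiden P * 'X_ord_max + mwiden Q))
   + h * mwiden A' + h * mwiden B' * 'X_ord_max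
   + h' * mwiden A + h' * mwiden B * 'X_ord_max + mwiden B * mwiden B'),
  (A * A' - B * B' * Q), (A * B' + A' * B + B * B' * P).
rewrite !(mwidenB, mwidenD, mwidenM).
move: 'X_ord_max (mwiden P) (mwiden Q) (mwiden A) (mwiden B) (mwiden A') (mwiden B').
by move=> z p0 q0 a b a' b'; ring.
Qed.

Section Generates.
Variable K : numClosedFieldType.

(** Let A + B t(5) be the remainder of g. Subtracting its values at a pair and at the transposed
    pair gives B u = 0. Since u^2 = P^2 - 4 Q is not identically zero, density yields B = 0 and then
    A = 0. *)
Lemma hypersurface_generates (P Q : {mpoly K[8]}) :
  (forall rho, HomF2 rho -> (hypersurface_eqn P Q).@[trace_coords rho] = 0) ->
  (forall x y, SL3 x -> SL3 y -> P.@[fun i => trace_coords (x, y) (widen8 i)] =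
     trace_coords (x, y) ord_max + trace_coords (x^T, y^T) ord_max) ->
  generates_ideal_of_X (hypersurface_eqn P Q).
Proof.
move=> f0 PE g; split=> [g0|[h ->] rho hrho]; last first.
  by rewrite mevalM f0 // mulr0.
have [h [A [B Eg]]] := hypersurface_divide P Q g.
have AB x y : SL3 x -> SL3 y -> let t i := trace_coords (x, y) (widen8 i) in
  A.@[t] + B.@[t] * trace_coords (x, y) ord_max = 0.
  move=> dx dy t; have := g0 _ (conj dx dy : HomF2 (x, y)).
  rewrite Eg !mevalD !mevalM f0; last exact: conj.
  by rewrite mulr0 add0r !meval_mwiden mevalXU.
have sep x y : SL3 x -> SL3 y -> let t i := trace_coords (x, y) (widen8 i) in
  B.@[t] * \det (x *m y - y *m x) = 0
  /\ (P ^+ 2 - 4 *: Q).@[t] = (\det (x *m y - y *m x)) ^+ 2.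
  move=> dx dy t; have [[/= dx' dy'] Et Eu] := transpose_trace dx dy.
  have := AB _ _ dx' dy'; cbv zeta; rewrite !(meval_eq _ Et) -/t => AB'; have := AB _ _ dx dy.
  cbv zeta; rewrite -/t -Eu => ABxy; split.
    transitivity ((A.@[t] + B.@[t] * trace_coords (x, y) ord_max) -
      (A.@[t] + B.@[t] * trace_coords (x^T, y^T) ord_max)); first by ring.
    by rewrite ABxy AB' subrr.
  rewrite mevalB mevalZ rmorphXn /= (PE _ _ dx dy).
  have := f0 _ (conj dx dy : HomF2 (x, y)).
  rewrite /hypersurface_eqn mevalD mevalB rmorphXn mevalM /= !meval_mwiden mevalXU.
  rewrite (PE _ _ dx dy) -/t.
  move: (trace_coords _ _) (trace_coords _ _) (_.@[t]) => c c' q EQ.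
  by rewrite -[RHS]addr0 -[X in _ = _ + X](mulr0 (-4)) -EQ; ring.
have D0 : P ^+ 2 - 4 *: Q != 0 :> {mpoly K[8]}.
  (* A pair with det (xy - yx) = -2 shows that the discriminant of f is not the zero polynomial. *)
  apply/eqP=> D0; pose x : 'M[K]_3 := mx3 0 1 0 0 0 1 1 0 0.
  pose y : 'M[K]_3 := mx3 0 0 1 1 0 1 2 1 0.
  have dx : SL3 x by rewrite /SL3 /= det_mx3; ring.
  have dy : SL3 y by rewrite /SL3 /= det_mx3; ring.
  have [_] := sep x y dx dy; rewrite D0 meval0 => /esym/eqP.
  rewrite expf_eq0 /= !(mul_mx3, opp_mx3, add_mx3, det_mx3) (_ : _ + _ = - 2).
    by rewrite oppr_eq0 pnatr_eq0.
  by ring.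
have B0 : B = 0.
  have /eqP : B * (P ^+ 2 - 4 *: Q) = 0.
    apply: trace_coords_dense => x y dx dy; have [Bu Du] := sep x y dx dy.
    by rewrite mevalM Du exprS mulrA Bu mul0r.
  by rewrite mulf_eq0 (negbTE D0) orbF => /eqP.
have A0 : A = 0.
  apply: trace_coords_dense => x y dx dy.
  by have := AB x y dx dy; cbv zeta; rewrite B0 meval0 mul0r addr0.
by exists h; rewrite Eg A0 B0 !mwiden0 mul0r !addr0.
Qed.

End Generates.

(* The values of the nine trace functions on two blocks of [GL_2] with traces
   [a], [b], determinants [d], [e], and trace [c] of their product. *)
Lemma tderiv_block (K : fieldType) (a b c d e : K) i : (i < 9)%N -> d != 0 -> e != 0 ->
  teval [:: a + d^-1; a / d + d; b + e^-1; b / e + e; c + (d * e)^-1;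
            c / (d * e) + d * e; (a * b - c) / e + e / d; (a * b - c) / d + d / e;
            1 + (a ^+ 2 * e + b ^+ 2 * d + c ^+ 2 - a * b * c - 2 * d * e) / (d * e)]
    (tderiv i Fexp) = 0.
Proof.
move=> hi d0 e0; do 9![case: i hi => [_|i hi]; first by
  (match goal with |- context [tderiv ?i Fexp] =>
     let D := eval vm_compute in (tderiv i Fexp) in change (tderiv i Fexp) with D
   end; lazy [teval nth]; field; rewrite d0 e0)].
done.
Qed.

(** * The gradient at block diagonal pairs *)

Section BlockDiagonal.
Variable K : fieldType.

Lemma SL3_GL2P (x : 'M[K]_3) : SL3_GL2 x <->
  exists a b c d, a * d - b * c != 0 /\ x = mx3 a b 0 c d 0 0 0 (a * d - b * c)^-1.
Proof.
have e0 : o0 = lshift 1 (0 : 'I_2) by apply: val_inj.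
have e1 : o1 = lshift 1 (1 : 'I_2) by apply: val_inj.
have e2 : o2 = rshift 2 (0 : 'I_1) by apply: val_inj.
have E (A : 'M[K]_2) : block_mx A 0 0 ((\det A)^-1)%:M =
    mx3 (A 0 0) (A 0 1) 0 (A 1 0) (A 1 1) 0 0 0 (\det A)^-1 :> 'M_3.
  apply: mx3P; rewrite [RHS]mxE /= ?e0 ?e1 ?e2.
  all: try exact: (block_mxEul A 0 0 ((\det A)^-1)%:M).
  all: try by apply: etrans (block_mxEur A 0 0 ((\det A)^-1)%:M _ _) _; rewrite mxE.
  all: try by apply: etrans (block_mxEdl A 0 0 ((\det A)^-1)%:M _ _) _; rewrite mxE.
  by apply: etrans (block_mxEdr A 0 0 ((\det A)^-1)%:M _ _) _; rewrite mxE.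
split=> [[A /= dA <-]|[a [b [c [d [nz ->]]]]]].
  by exists (A 0 0), (A 0 1), (A 1 0), (A 1 1); rewrite E -det2.
pose A : 'M[K]_2 := \matrix_(i, j) nth 0 (nth [::] [:: [:: a; b]; [:: c; d]] i) j.
have dA : \det A = a * d - b * c by rewrite det2 !mxE.
by exists A; rewrite /= ?E ?dA // !mxE.
Qed.

Lemma SL3_GL2_SL3 : @SL3_GL2 K `<=` @SL3 K.
Proof.
move=> _ /SL3_GL2P[a [b [c [d [nz ->]]]]].
by rewrite /SL3 /= det_mx3; field.
Qed.

Lemma gradient_SL3_GL2 (x y : 'M[K]_3) (i : 'I_9) : SL3_GL2 x -> SL3_GL2 y ->
  ((hypersurface_eqn (Ppoly K) (Qpoly K))^`M(i)).@[trace_coords (x, y)] = 0.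
Proof.
move=> hx hy; rewrite hypersurface_PQ mderiv_teval meval_teval map_trace_coords;
  try exact: SL3_GL2_SL3.
move: hx hy => /SL3_GL2P[a [b [c [d [nx ->]]]]] /SL3_GL2P[a' [b' [c' [d' [ny ->]]]]].
rewrite -[RHS](@tderiv_block _ (a + d) (a' + d') (a * a' + b * c' + c * b' + d * d') _ _
  i (ltn_ord i) nx ny); congr teval.
rewrite /twords /= !(adj_mx3, mul_mx3, trace_mx3).
do 9![apply: (congr2 cons); first by field; rewrite ?nx ?ny].
by [].
Qed.

End BlockDiagonal.

(** * Symmetrizing a pair of matrices *)

Definition row3 (L : nmodType) (a b c : L) : 'rV[L]_3 := \row_i nth 0 [:: a; b; c] i.

Lemma row3E (L : nmodType) (v : 'rV[L]_3) : v = row3 (v 0 o0) (v 0 o1) (v 0 o2).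
Proof. by apply/rowP; elim/ord3P; rewrite mxE. Qed.

Lemma row3P (L : nmodType) (v w : 'rV[L]_3) :
  v 0 o0 = w 0 o0 -> v 0 o1 = w 0 o1 -> v 0 o2 = w 0 o2 -> v = w.
Proof. by move=> *; rewrite (row3E v) (row3E w); congr row3. Qed.

Section Row3.
Variable L : comNzRingType.

Lemma mul_row3 (a b c m11 m12 m13 m21 m22 m23 m31 m32 m33 : L) :
  row3 a b c *m mx3 m11 m12 m13 m21 m22 m23 m31 m32 m33 =
  row3 (a * m11 + b * m21 + c * m31) (a * m12 + b * m22 + c * m32)
       (a * m13 + b * m23 + c * m33).
Proof. by apply: row3P; rewrite !mxE sum3 !mxE. Qed.

Lemma dot_row3 (a b c a' b' c' : L) i j :
  (row3 a b c *m (row3 a' b' c')^T) i j = a * a' + b * b' + c * c'.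
Proof. by rewrite !mxE sum3 !mxE. Qed.

Definition cross (v w : 'rV[L]_3) : 'rV[L]_3 :=
  row3 (v 0 o1 * w 0 o2 - v 0 o2 * w 0 o1) (v 0 o2 * w 0 o0 - v 0 o0 * w 0 o2)
       (v 0 o0 * w 0 o1 - v 0 o1 * w 0 o0).

(** The matrix of the cross product with e on row vectors: [v *m crossmx e = cross e v]. On skew
    matrices [axial] inverts it. *)
Definition crossmx (e : 'rV[L]_3) : 'M[L]_3 :=
  mx3 0 (e 0 o2) (- e 0 o1) (- e 0 o2) 0 (e 0 o0) (e 0 o1) (- e 0 o0) 0.

Lemma tr_crossmx e : (crossmx e)^T = - crossmx e.
Proof. by rewrite /crossmx tr_mx3 opp_mx3 oppr0 !opprK. Qed.

Lemma crossmx0 : crossmx 0 = 0.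
Proof. by apply: mx3P; rewrite !mxE /= ?oppr0. Qed.

(** Cyclic invariance of the scalar triple product. *)
Lemma crossmx_dot (k e w : 'rV[L]_3) :
  (k *m crossmx e *m w^T) 0 0 = (e *m (cross k w)^T) 0 0.
Proof.
rewrite (row3E k) (row3E w) /crossmx /cross mul_row3 dot_row3 (row3E e) dot_row3 !mxE /=; ring.
Qed.

(** Transposition changes z into -z, so odd powers of z are absent; the quadratic term pairs X with
    the adjugate of [crossmx e], which is [e^T *m e]. *)
Lemma det_symD_crossmx (X : 'M[L]_3) e z : X^T = X ->
  \det (X + z *: crossmx e) = \det X + z ^+ 2 * (e *m X *m e^T) 0 0.
Proof.
move=> Xs; have E i j : X i j = X j i by rewrite -[in RHS]Xs mxE.
rewrite (mx3E X) (row3E e) (E o1 o0) (E o2 o0) (E o2 o1) mul_row3 dot_row3.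
rewrite /crossmx !mxE /= scale_mx3 add_mx3 !det_mx3; ring.
Qed.

Definition axial (A : 'M[L]_3) : 'rV[L]_3 := row3 (A o1 o2) (A o2 o0) (A o0 o1).

Lemma axial_linear (a : L) (A B : 'M[L]_3) : axial (a *: A + B) = a *: axial A + axial B.
Proof. by apply: row3P; rewrite !mxE. Qed.

Lemma crossmx_axial (A : 'M[L]_3) : A^T = - A -> (forall i, A i i = 0) ->
  crossmx (axial A) = A.
Proof.
move=> As Ad; have E i j : A i j = - A j i.
  by have := congr1 (fun M : 'M[L]_3 => M j i) As; rewrite !mxE.
apply: mx3P; rewrite !mxE /= ?Ad // -E //.
Qed.

Lemma detD_mx3 (A M : 'M[L]_3) z : \det (A + z *: M) =
  \det A + z * \tr (\adj A *m M) + z ^+ 2 * \tr (A *m \adj M) + z ^+ 3 * \det M.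
Proof.
rewrite (mx3E A) (mx3E M) !(adj_mx3, scale_mx3, add_mx3, mul_mx3, trace_mx3, det_mx3).
ring.
Qed.

Lemma adj_crossmx e : \adj (crossmx e) = e^T *m e.
Proof.
rewrite /crossmx adj_mx3; apply: mx3P; rewrite !mxE big_ord1 !mxE /=; ring.
Qed.

Lemma det_crossmx e : \det (crossmx e) = 0.
Proof. by rewrite /crossmx det_mx3; ring. Qed.

End Row3.

Lemma row_neq0 (K : fieldType) n (v : 'rV[K]_n) : v != 0 -> exists i, v 0 i != 0.
Proof.
move=> v0; apply/existsP; apply: contraNT v0 => /existsPn v0.
apply/eqP/rowP=> i; rewrite mxE; apply/eqP.
by have := v0 i; rewrite negbK.
Qed.

Section Cross.
Variable K : fieldType.

Lemma cross_eq0 (v w : 'rV[K]_3) : v != 0 -> cross v w = 0 -> (w <= v)%MS.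
Proof.
move=> v0 vw; have E i := congr1 (fun u : 'rV[K]_3 => u 0 i) vw.
have := E o0; have := E o1; have := E o2; rewrite !mxE /= => E2 E1 E0.
have par i j : v 0 i * w 0 j = v 0 j * w 0 i.
  by move: i j; elim/ord3P; elim/ord3P => //; apply/eqP;
     rewrite -subr_eq0 ?E0 ?E1 ?E2 // -oppr_eq0 opprB ?E0 ?E1 ?E2.
have [i vi] := row_neq0 v0.
apply/sub_rVP; exists (w 0 i / v 0 i); apply/rowP=> j; rewrite mxE.
by rewrite mulrAC [_ * v 0 j]mulrC -par mulrAC mulfV // mul1r.
Qed.

Definition row_eig (x y : 'M[K]_3) :=
  exists2 v : 'rV[K]_3, v != 0 & stablemx v x /\ stablemx v y.

(** In dimension three a proper nonzero invariant subspace is a line, or a plane whose annihilator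
    is an invariant line of the dual. *)
Definition reducible2 (x y : 'M[K]_3) := row_eig x y \/ row_eig x^T y^T.

Lemma rank1_row_eig m (N : 'M[K]_(m, 3)) x y : \rank N = 1 ->
  stablemx N x -> stablemx N y -> row_eig x y.
Proof.
move=> rN Nx Ny; exists (nz_row N).
  by rewrite nz_row_eq0 -mxrank_eq0 rN.
have E : (nz_row N :=: N)%MS.
  apply/eqmxP; rewrite -(mxrank_leqif_eq (nz_row_sub N)) rN rank_rV nz_row_eq0.
  by rewrite -mxrank_eq0 rN.
by rewrite !(eqmx_stable _ E).
Qed.

Lemma stable_reducible m (N : 'M[K]_(m, 3)) x y : (0 < \rank N < 3)%N ->
  stablemx N x -> stablemx N y -> reducible2 x y.
Proof.
case/andP=> N0 N3 Nx Ny; have [N1|N2] : \rank N = 1 \/ \rank N = 2.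
- by move: (\rank N) N0 N3 => [|[|[|]]] //; [left | right].
- by left; apply: rank1_row_eig N1 Nx Ny.
(* The annihilator of a stable plane is a line stable under the transposes. *)
right; apply: (@rank1_row_eig _ (kermx N^T)).
- by rewrite mxrank_ker mxrank_tr N2.
- apply/sub_kermxP; have /submxP[D ED] := Nx.
  by rewrite -mulmxA -trmx_mul ED trmx_mul mulmxA mulmx_ker mul0mx.
- apply/sub_kermxP; have /submxP[D ED] := Ny.
  by rewrite -mulmxA -trmx_mul ED trmx_mul mulmxA mulmx_ker mul0mx.
Qed.

End Cross.

(** * The linear system for a symmetrizing matrix *)

Section Symmetrizer.
Variable K : fieldType.
Variables x y : 'M[K]_3.

Definition sym6 (b : 'rV[K]_6) : 'M[K]_3 :=
  mx3 (b 0 0) (b 0 1) (b 0 2) (b 0 1) (b 0 3) (b 0 4) (b 0 2) (b 0 4) (b 0 5).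

Let defect (A B : 'M[K]_3) := A *m B - B *m A^T.

(** For symmetric B the defect is skew, so its axial vector records it. This gives six equations in
    six unknowns, and a vanishing determinant produces a nonzero B. *)
Definition sym_defect (b : 'rV[K]_6) : 'rV[K]_6 :=
  (row_mx (axial (defect x (sym6 b))) (axial (defect y (sym6 b))) : 'rV_(3 + 3)).

Let row_mx33_eq0 (a b : 'rV[K]_3) : row_mx a b = 0 :> 'rV_6 -> a = 0 /\ b = 0.
Proof.
move=> E; have /eqP : row_mx a b = 0 :> 'rV_(3 + 3) by exact: E.
by rewrite row_mx_eq0 => /andP[/eqP -> /eqP ->].
Qed.

Let dot_row_mx33 (a b c d : 'rV[K]_3) :
  (row_mx a b : 'rV_6) *m (row_mx c d : 'rV_6)^T = a *m c^T + b *m d^T.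
Proof.
transitivity ((row_mx a b : 'rV_(3 + 3)) *m (row_mx c d : 'rV_(3 + 3))^T) => //.
by rewrite tr_row_mx mul_row_col.
Qed.

Lemma sym_defect_linear : linear sym_defect.
Proof.
move=> a b b'; rewrite /sym_defect.
have -> : sym6 (a *: b + b') = a *: sym6 b + sym6 b' by apply: mx3P; rewrite !mxE.
have E A : defect A (a *: sym6 b + sym6 b') = a *: defect A (sym6 b) + defect A (sym6 b').
  by rewrite /defect mulmxDr mulmxDl -scalemxAr -scalemxAl opprD addrACA -scalerBr.
by rewrite !E !axial_linear -add_row_mx -scale_row_mx.
Qed.

HB.instance Definition _ := GRing.isLinear.Build K _ _ _ sym_defect sym_defect_linear.

Let defectE A b : crossmx (axial (defect A (sym6 b))) = defect A (sym6 b).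
Proof.
have Bs : (sym6 b)^T = sym6 b by rewrite tr_mx3.
apply: crossmx_axial => [|i]; first by rewrite linearB /= !trmx_mul trmxK Bs opprB.
rewrite !mxE; apply/eqP; rewrite subr_eq0; apply/eqP/eq_bigr => j _.
by rewrite [A^T _ _]mxE mulrC -[in LHS]Bs mxE.
Qed.

(* For [k] in the kernel of [xy - yx] the defects satisfy
   [k (xB - B x^T) (k y)^T = k (yB - B y^T) (k x)^T]: the six equations for the
   six entries of [B] are dependent. *)
Lemma symmetrizer_exists (k : 'rV[K]_3) : k != 0 -> k *m (x *m y - y *m x) = 0 ->
  ~ row_eig x y -> exists2 B, B != 0 & [/\ B^T = B, x *m B = B *m x^T & y *m B = B *m y^T].
Proof.
move=> k0 kxy nred.
have {}kxy : k *m x *m y = k *m y *m x.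
  by apply/eqP; rewrite -subr_eq0 -!mulmxA -mulmxBr kxy.
(* The coefficients of the linear dependence, read off through [crossmx_dot]. *)
pose c : 'rV[K]_6 :=
  (row_mx (cross k (k *m y)) (- cross k (k *m x)) : 'rV_(3 + 3)).
have c0 : c != 0.
  apply/eqP=> /row_mx33_eq0[cy /eqP]; rewrite oppr_eq0 => /eqP cx.
  by apply: nred; exists k => //; split; apply: cross_eq0.
have fc b : sym_defect b *m c^T = 0.
  apply/matrixP=> i j; rewrite !ord1 [RHS]mxE dot_row_mx33 [LHS]mxE.
  rewrite linearN /= mulmxN [X in _ + X]mxE -!crossmx_dot !defectE /defect.
  set B := sym6 b; have Bs : B^T = B by rewrite tr_mx3.
  rewrite !mulmxBr !mulmxBl !mulmxA [X in X - _]mxE [X in _ - X]mxE.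
  rewrite [X in _ + X - _]mxE [X in _ - (_ + X)]mxE.
  have T (u v : 'rV[K]_3) : (u *m B *m v^T) 0 0 = (v *m B *m u^T) 0 0.
    by rewrite -[in LHS](trmxK (u *m B)) -trmx_mul mxE trmx_mul Bs mulmxA.
  have R (u : 'rV[K]_3) A : k *m B *m A^T *m u^T = k *m B *m (u *m A)^T.
    by rewrite trmx_mul !mulmxA.
  by rewrite !R (T (k *m x)) kxy; ring.
have /det0P[b b0 Lb] : \det (lin1_mx sym_defect) == 0.
  rewrite -det_tr; apply/det0P; exists c => //; apply/trmx_inj; rewrite trmx_mul trmxK trmx0.
  by apply/row_matrixP=> i; rewrite row_mul rowE mul_rV_lin1 row0; exact: fc.
rewrite mul_rV_lin1 in Lb; exists (sym6 b).
  apply: contraNneq b0 => /matrixP B0; apply/eqP/rowP=> i; rewrite mxE.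
  have := B0 o0 o0; have := B0 o0 o1; have := B0 o0 o2.
  have := B0 o1 o1; have := B0 o1 o2; have := B0 o2 o2; rewrite !mxE /= => E5 E4 E3 E2 E1 E0.
  by case: i => [[|[|[|[|[|[|//]]]]]] hi]; [rewrite -[RHS]E0|rewrite -[RHS]E1|rewrite -[RHS]E2
    |rewrite -[RHS]E3|rewrite -[RHS]E4|rewrite -[RHS]E5]; congr (b _ _); apply: val_inj.
have [Lx Ly] := row_mx33_eq0 Lb.
split; first by rewrite tr_mx3.
- by apply/eqP; rewrite -subr_eq0 -[_ - _](defectE x) Lx crossmx0.
- by apply/eqP; rewrite -subr_eq0 -[_ - _](defectE y) Ly crossmx0.
Qed.

(** Schur's argument: B intertwines the pair with its transpose, so its left kernel is stable under
    x and y. *)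
Lemma symmetrizer_unit (B : 'M[K]_3) : B != 0 -> x *m B = B *m x^T -> y *m B = B *m y^T ->
  ~ reducible2 x y -> B \in unitmx.
Proof.
move=> B0 Bx By nred; rewrite -row_free_unit -kermx_eq0; apply: contraT => ker0.
case: nred; apply: (@stable_reducible _ _ (kermx B)).
- rewrite lt0n mxrank_eq0 ker0 mxrank_ker -subn_gt0 subKn ?rank_leq_row //.
  by rewrite lt0n mxrank_eq0.
- by apply/sub_kermxP; rewrite -mulmxA Bx mulmxA mulmx_ker mul0mx.
- by apply/sub_kermxP; rewrite -mulmxA By mulmxA mulmx_ker mul0mx.
Qed.

End Symmetrizer.

(** If all isotropic vectors lay in the plane orthogonal to w, that plane would be totally isotropic
    and orthogonal to a vector u outside it, so the form would be degenerate. *)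
Lemma isotropic_off_line (K : numClosedFieldType) (X : 'M[K]_3) (w : 'rV[K]_3) :
  X^T = X -> X \in unitmx -> w != 0 ->
  exists e : 'rV[K]_3, (e *m X *m e^T) 0 0 = 0 /\ (e *m w^T) 0 0 != 0.
Proof.
move=> Xs uX w0; pose q (u v : 'rV[K]_3) : K := (u *m X *m v^T) 0 0.
pose d (u : 'rV[K]_3) : K := (u *m w^T) 0 0.
have qD1 (u u' v : 'rV[K]_3) : q (u + u') v = q u v + q u' v by rewrite /q !mulmxDl mxE.
have qZ1 a (u v : 'rV[K]_3) : q (a *: u) v = a * q u v by rewrite /q -!scalemxAl mxE.
have qC u v : q u v = q v u.
  rewrite /q -[in LHS](trmxK (u *m X)) -trmx_mul mxE trmx_mul Xs mulmxA //.
have qD2 (u v v' : 'rV[K]_3) : q u (v + v') = q u v + q u v' by rewrite !(qC u) qD1.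
have qZ2 a (u v : 'rV[K]_3) : q u (a *: v) = a * q u v by rewrite !(qC u) qZ1.
have dD (u v : 'rV[K]_3) : d (u + v) = d u + d v by rewrite /d mulmxDl mxE.
have dZ a (u : 'rV[K]_3) : d (a *: u) = a * d u by rewrite /d -scalemxAl mxE.
have nd (u : 'rV[K]_3) : u != 0 -> exists v : 'rV_3, (v *m u^T) 0 0 != 0.
  move=> u0; have [i ui] := row_neq0 u0.
  by exists (delta_mx 0 i); rewrite -rowE !mxE.
apply: contrapT => none.
have iso e : q e e = 0 -> d e = 0.
  by move=> qe; apply/eqP; apply: contrapT => /negP de; apply: none; exists e.
have [u du] : exists u, d u != 0 by exact: nd.
have qu : q u u != 0 by apply: contraNneq du => /iso ->.
have key e : d e = 0 -> q u e = 0 /\ q e e = 0.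
  move=> de; have [c [c' [Es Ep]]] :=
    quadratic_roots (- (2 * q u e) / q u u) (q e e / q u u).
  (* A root b of z -> q (z u + e) gives an isotropic vector, which lies in the plane only if b = 0.
     Both roots being 0, the coefficients q u e and q e e vanish. *)
  have root0 b b' : b + b' = c + c' -> b * b' = c * c' -> b = 0.
    move=> Es' Ep'; have : d (b *: u + e) = 0.
      apply: iso; rewrite qD1 !qD2 !qZ1 !qZ2 (qC e u).
      have -> : q e e = q u u * (b * b') by rewrite Ep' Ep mulrC divfK.
      have -> : q u e = - (q u u * (b + b')) / 2 by rewrite Es' Es; field.
      by field.
    by rewrite dD dZ de addr0 => /eqP; rewrite mulf_eq0 (negbTE du) orbF => /eqP.
  have c0 := root0 c c' erefl erefl.
  have c'0 := root0 c' c (addrC _ _) (mulrC _ _).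
  move: Es Ep; rewrite c0 c'0 addr0 mulr0 => /esym/eqP + /esym/eqP.
  rewrite !mulf_eq0 invr_eq0 (negbTE qu) !orbF oppr_eq0 mulf_eq0 pnatr_eq0 /=.
  by move=> /eqP + /eqP.
pose e := nz_row (kermx w^T).
have e0 : e != 0.
  by rewrite nz_row_eq0 -mxrank_eq0 mxrank_ker mxrank_tr rank_rV w0.
have de : d e = 0.
  by rewrite /d (sub_kermxP (nz_row_sub _)) mxE.
have eX : e *m X != 0.
  by apply: contraNneq e0 => eX; rewrite -[e](mulmxK uX) eX mul0mx.
have [v] := nd _ eX; rewrite trmx_mul Xs mulmxA -/(q v e) qC => /eqP; apply.
(* v is split into a multiple of u and a vector v' of the plane; polarizing q on e + v' gives q e v'
   = 0. *)
have [v' Ev'] : exists v', v' = v - (d v / d u) *: u by eexists.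
have dv' : d v' = 0 by rewrite Ev' -scaleNr dD dZ mulNr divfK // subrr.
have dev : d (e + v') = 0 by rewrite dD de dv' addr0.
have [que qee] := key _ de; have [_ qvv] := key _ dv'; have [_] := key _ dev.
rewrite qD1 !qD2 qee qvv add0r addr0 (qC v') -mulr2n => /eqP.
rewrite mulrn_eq0 /= => /eqP qev'.
have -> : v = v' + (d v / d u) *: u by rewrite Ev' subrK.
by rewrite qD2 qev' qZ2 qC que mulr0 addr0.
Qed.

(** * Smoothness at irreducible representations *)

Lemma poly_split2 (K : fieldType) (p : {poly K}) :
  exists r, p = (p`_0)%:P + (p`_1)%:P * 'X + 'X^2 * r.
Proof.
exists (drop_poly 2 p); rewrite -[in LHS](poly_take_drop 2 p) ['X^2 * _]mulrC.
congr (_ + _); apply/polyP=> i; rewrite coef_take_poly coefD coefC coefCM coefX.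
by case: i => [|[|i]] /=; rewrite ?mulr1 ?mulr0 ?addr0 ?add0r.
Qed.

Lemma mderiv_hypersurface (K : fieldType) (P Q : {mpoly K[8]}) (a : 'I_9 -> K) :
  let t i := a (widen8 i) in
  ((hypersurface_eqn P Q)^`M(ord_max)).@[a] = 2 * a ord_max - P.@[t] /\
  forall i, ((hypersurface_eqn P Q)^`M(widen8 i)).@[a] =
    Q^`M(i).@[t] - P^`M(i).@[t] * a ord_max.
Proof.
have XD (i : 'I_9) : ('X_ord_max : {mpoly K[9]})^`M(i) = (i == ord_max)%:R.
  rewrite mderivX mnmE eq_sym; case: eqP => [->|_]; last by rewrite scale0r.
  rewrite scale1r (_ : U_(_) - _ = 0)%MM ?mpolyX0 //.
  by apply/mnmP=> l; rewrite !mnmE subnn.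
split=> [|i]; rewrite /hypersurface_eqn expr2 mderivD mderivB !mderivM !XD.
  rewrite eqxx !mderiv_mwiden_max !mul0r !mulr1 mul1r add0r addr0.
  by rewrite mevalB mevalD meval_mwiden mevalXU; ring.
rewrite -val_eqE /= (ltn_eqF (ltn_ord i)) !mderiv_mwiden mul0r !mulr0 !addr0 add0r.
by rewrite mevalD mevalN mevalM !meval_mwiden mevalXU; ring.
Qed.

(* Along such a curve [f] has [z^2]-coefficient [T_max'(0)^2] when its gradient
   at the base point is [0]. *)
Lemma singular_curve (K : numFieldType) (P Q : {mpoly K[8]}) (T : 'I_9 -> {poly K}) :
  (forall z, (hypersurface_eqn P Q).@[fun i => (T i).[z]] = 0) ->
  (forall i, ((hypersurface_eqn P Q)^`M(i)).@[fun i => (T i).[0]] = 0) ->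
  (forall i, (T (widen8 i))`_1 = 0) -> (T ord_max)`_1 = 0.
Proof.
move=> f0 df0 T1; set a := fun i => (T i).[0] in df0.
have [Dmax Dw] := mderiv_hypersurface P Q a.
set t := fun i => a (widen8 i) in Dmax Dw.
(* The first eight coordinates have no linear term, so the Taylor expansion applies with k = 2. *)
have /choice[r Er] : forall i, exists r, T (widen8 i) = (t i)%:P + 'X^2 * r.
  move=> i; have [r Er] := poly_split2 (T (widen8 i)); exists r.
  by rewrite [LHS]Er T1 polyC0 mul0r addr0 /t /a horner_coef0.
have : mmap polyC T (hypersurface_eqn P Q) = 0.
  apply: (poly0_of_horner (r := 1)); first exact: oner_neq0.
  by move=> z _; rewrite -meval_curve f0.
rewrite /hypersurface_eqn rmorphD rmorphB rmorphXn rmorphM /= !mmap_mwiden mmapX mmap1U.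
rewrite (funext Er).
have [w ->] := mmap_taylor1 P t r 2; have [w' ->] := mmap_taylor1 Q t r 2.
set A := \sum_i _; set B := \sum_i _; have [r8 Er8] := poly_split2 (T ord_max).
set s0 := _`_0 in Er8; set s1 := _`_1 in Er8 *.
have Es0 : a ord_max = s0 by rewrite /a horner_coef0.
have p0 : P.@[t] = 2 * s0.
  by have := df0 ord_max; rewrite Dmax Es0 => /eqP; rewrite subr_eq0 => /eqP.
(* The vanishing gradient makes the quadratic contributions of P and Q cancel, leaving only s1^2. *)
have BA : B = s0%:P * A.
  rewrite /A /B mulr_sumr; apply: eq_bigr => i _; have := df0 (widen8 i).
  rewrite Dw Es0 => /eqP; rewrite subr_eq0 => /eqP ->.
  by rewrite mul_polyC scalerA mulrC.
rewrite Er8 BA p0.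
move=> /(congr1 (coefp 2)); rewrite /= coef0.
rewrite (_ : _ + _ = (Q.@[t] - s0 ^+ 2)%:P + 'X^2 * (s1 ^+ 2)%:P + 'X^3 *
  (2 * s1%:P * r8 - A * s1%:P
   + 'X * (r8 ^+ 2 - A * r8 - w * s0%:P + w') - 'X^2 * w * s1%:P - 'X^3 * w * r8)).
  rewrite !coefD coefC !coefXnM /= coefC addr0 add0r => /eqP.
  by rewrite expf_eq0 => /eqP.
rewrite polyCB polyCM !polyC_exp; ring.
Qed.

Lemma twords_morph (L L' : comNzRingType) (h : {rmorphism L -> L'}) (x y x' y' : 'M[L]_3) i :
  h (tnth (twords x y x' y') i) =
  tnth (twords (map_mx h x) (map_mx h y) (map_mx h x') (map_mx h y')) i.
Proof.
rewrite -(tnth_map h); congr (tnth _ i); apply: val_inj.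
by rewrite /= -!map_mxM !trace_map_mx.
Qed.

(** Stated for any invertible g because the symmetrizer does not come with determinant 1. *)
Lemma conj_unit_trace (K : fieldType) (g x y : 'M[K]_3) : g \in unitmx -> SL3 x -> SL3 y ->
  [/\ SL3 (g *m x *m invmx g), SL3 (g *m y *m invmx g) &
    trace_coords (g *m x *m invmx g, g *m y *m invmx g) = trace_coords (x, y)].
Proof.
move=> ug dx dy; have dconj A : SL3 A -> SL3 (g *m A *m invmx g).
  move=> dA; rewrite /SL3 /= !det_mulmx det_inv dA mulr1 divff //.
  by rewrite -unitfE -unitmxE.
have uSL (A : 'M[K]_3) : SL3 A -> A \in unitmx by move=> dA; rewrite unitmxE dA unitr1.
have Ei A : SL3 A -> invmx (g *m A *m invmx g) = g *m invmx A *m invmx g.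
  move=> dA; have uc := uSL _ (dconj _ dA).
  apply: (can_inj (mulKmx uc)); rewrite mulmxV //.
  by rewrite !mulmxA mulmxKV // mulmxK ?uSL // mulmxV.
have EM (A B : 'M[K]_3) :
  g *m A *m invmx g *m (g *m B *m invmx g) = g *m (A *m B) *m invmx g.
  by rewrite !mulmxA mulmxKV.
have ET (A : 'M[K]_3) : \tr (g *m A *m invmx g) = \tr A.
  by rewrite mxtrace_mulC mulKmx.
split; [exact: dconj | exact: dconj |].
by apply: funext => i; rewrite /trace_coords /= !Ei // !EM !ET.
Qed.

(** The two terms of the trace are transposes of each other up to sign, since [crossmx e] is skew;
    hence the factor 2. *)
Lemma trace_crossmx (L : comNzRingType) (k e : 'rV[L]_3) (A : 'M[L]_3) :
  \tr (k^T *m k *m (crossmx e *m A^T - A *m crossmx e)) = 2 * (k *m crossmx e *m (k *m A)^T) 0 0.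
Proof.
have kkE (a b c : L) : (row3 a b c)^T *m row3 a b c =
    mx3 (a * a) (a * b) (a * c) (b * a) (b * b) (b * c) (c * a) (c * b) (c * c).
  by apply: mx3P; rewrite !mxE big_ord1 !mxE.
rewrite (row3E k) kkE (mx3E A) /crossmx tr_mx3 !(mul_mx3, opp_mx3, add_mx3, mul_row3).
rewrite trace_mx3 dot_row3. ring.
Qed.

(** Used with g the symmetrizer, c its inverse and a', b' the transposes of a, b: taking c out on
    the right leaves a pencil whose constant term (ab - ba)g is skew. *)
Lemma deform_comm (L : comNzRingType) n (z : L) (a b d d' c a' b' g : 'M[L]_n) :
  c *m a = a' *m c -> c *m b = b' *m c -> g *m c = 1%:M ->
  (a + z *: (d *m c)) *m (b + z *: (d' *m c)) - (b + z *: (d' *m c)) *m (a + z *: (d *m c)) =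
  ((a *m b - b *m a) *m g + z *: ((d *m b' - b *m d - (d' *m a' - a *m d'))
     + z *: (d *m c *m d' - d' *m c *m d))) *m c.
Proof.
move=> ca cb gc.
have sl k (u v : 'M[L]_n) : (k *: u) *m v = k *: (u *m v) by rewrite -scalemxAl.
have sr k (u v : 'M[L]_n) : u *m (k *: v) = k *: (u *m v) by rewrite -scalemxAr.
rewrite !(mulmxDl, mulmxDr, mulNmx, mulmxN, opprD, opprK, sl, sr, scalerDr, scalerN, mulmxA).
rewrite -(mulmxA _ g) gc mulmx1 -(mulmxA _ g) gc mulmx1.
rewrite -(mulmxA d c b) cb -(mulmxA d' c a) ca !mulmxA.
move: (a *m b) (b *m a) (d *m b' *m c) (b *m d *m c) (d' *m a' *m c) (a *m d' *m c).
move: (d *m c *m d' *m c) (d' *m c *m d *m c) => m1 m2 m3 m4 m5 m6 m7 m8.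
apply/matrixP=> i j; rewrite !mxE; ring.
Qed.

(** * Lines reversed by the involution *)

Section Deformation.
Variable K : numClosedFieldType.
Variables (x y B : 'M[K]_3) (e f : 'rV[K]_3).
Hypotheses (dx : SL3 x) (dy : SL3 y) (uB : B \in unitmx).
Hypotheses (Bs : B^T = B) (Bx : x *m B = B *m x^T) (By : y *m B = B *m y^T).
Hypotheses (e0 : (e *m (x *m B) *m e^T) 0 0 = 0) (f0 : (f *m (y *m B) *m f^T) 0 0 = 0).
Let C := invmx B.

(** Multiplied by B this is the symmetric matrix AB plus z times a skew one, so the involution
    sending M to B M^T B^-1 changes z into -z. *)
Definition deform (A : 'M[K]_3) (a : 'rV[K]_3) z := A + z *: (crossmx a *m C).

(** Isotropy of a for AB removes the quadratic term in [det_symD_crossmx], so the whole line stays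
    in SL_3. *)
Let deform_SL3 A a z : SL3 A -> A *m B = B *m A^T -> (a *m (A *m B) *m a^T) 0 0 = 0 ->
  SL3 (deform A a z).
Proof.
move=> dA BA a0; rewrite /SL3 /= /deform.
have -> : A + z *: (crossmx a *m C) = (A *m B + z *: crossmx a) *m C.
  by rewrite mulmxDl mulmxK // scalemxAl.
rewrite det_mulmx det_symD_crossmx ?a0; last by rewrite trmx_mul Bs BA.
by rewrite mulr0 addr0 det_mulmx dA mul1r det_inv divff // -unitfE -unitmxE.
Qed.

Let deform_tr A a z : A *m B = B *m A^T ->
  (deform A a z)^T = C *m deform A a (- z) *m invmx C.
Proof.
move=> BA; have E1 : C *m A *m B = A^T by rewrite -mulmxA BA mulKmx.
rewrite /deform invmxK mulmxDr mulmxDl E1 linearD linearZ /=; congr (_ + _).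
rewrite trmx_mul tr_crossmx trmx_inv Bs -scalemxAr -scalemxAl !mulmxA mulmxKV //.
by rewrite mulmxN scalerN scaleNr.
Qed.

Let P z := (deform x e z, deform y f z).

Lemma deform_HomF2 z : HomF2 (P z).
Proof. by split; apply: deform_SL3. Qed.

(** The transpose of the pair at z is conjugate to the pair at -z, so the statements about
    transposition become statements about parity. *)
Lemma deform_even z : 
  (forall i, trace_coords (P z) (widen8 i) = trace_coords (P (- z)) (widen8 i)) /\
  trace_coords (P z) ord_max - trace_coords (P (- z)) ord_max =
    \det ((P z).1 *m (P z).2 - (P z).2 *m (P z).1).
Proof.
have [hx hy] := deform_HomF2 z; have [hx' hy'] := deform_HomF2 (- z).
have [_ Ew Em] := transpose_trace hx hy.
have uC : C \in unitmx by rewrite unitmx_inv.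
have [_ _ Ec] := conj_unit_trace uC hx' hy'.
have ET : trace_coords ((P z).1^T, (P z).2^T) = trace_coords (P (- z)).
  by rewrite [(P z).1^T]deform_tr // [(P z).2^T]deform_tr.
by rewrite -ET; split=> [i|]; [rewrite Ew | rewrite -Em].
Qed.

Let pmx (A : 'M[K]_3) : 'M[{poly K}]_3 := map_mx polyC A.
Let dp A a := pmx A + 'X *: pmx (crossmx a *m C).
(** The nine trace coordinates along the line, as polynomials in the parameter. *)
Let T i := tnth (twords (dp x e) (dp y f) (\adj (dp x e)) (\adj (dp y f))) i.

Let map_dp A a z : map_mx (horner_eval z) (dp A a) = deform A a z.
Proof.
rewrite /dp /deform map_mxD map_mxZ /= /horner_eval hornerX.
by congr (_ + _ *: _); apply/matrixP=> i j; rewrite !mxE /= hornerC.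
Qed.

Let map_adj_dp A a z : map_mx (horner_eval z) (\adj (dp A a)) = \adj (deform A a z).
Proof. by rewrite -(map_dp A a z) (map_mx_adj (horner_eval z) (dp A a)). Qed.

Lemma deform_trace z : (fun i => (T i).[z]) = trace_coords (P z).
Proof.
have [hx hy] := deform_HomF2 z; rewrite trace_coordsE //; apply: funext => i.
rewrite -horner_evalE (twords_morph (horner_eval z)).
congr (tnth (twords _ _ _ _) _);
  [exact: map_dp | exact: map_dp | exact: map_adj_dp | exact: map_adj_dp].
Qed.

(** The linear coefficient of a determinant is the trace of the perturbation against the adjugate of
    the constant term, here [k^T *m k]; [trace_crossmx] evaluates it. *)
Lemma deform_comm_coef1 (k : 'rV[K]_3) : (x *m y - y *m x) *m B = crossmx k ->
  (\det (dp x e *m dp y f - dp y f *m dp x e))`_1 =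
  \det C * (2 * ((k *m crossmx e *m (k *m y)^T) 0 0 - (k *m crossmx f *m (k *m x)^T) 0 0)).
Proof.
move=> kE; pose S := crossmx e *m y^T - y *m crossmx e - (crossmx f *m x^T - x *m crossmx f).
pose R := crossmx e *m C *m crossmx f - crossmx f *m C *m crossmx e.
have -> : dp x e *m dp y f - dp y f *m dp x e =
  (pmx (crossmx k) + 'X *: (pmx S + 'X *: pmx R)) *m pmx C.
  have Ecy : C *m y = y^T *m C by rewrite -[y in LHS](mulmxK uB) By -mulmxA mulKmx.
  have Ecx : C *m x = x^T *m C by rewrite -[x in LHS](mulmxK uB) Bx -mulmxA mulKmx.
  have -> : pmx (crossmx k) = (pmx x *m pmx y - pmx y *m pmx x) *m pmx B.
    by rewrite -kE /pmx map_mxM map_mxB !map_mxM.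
  rewrite /dp /S /R /pmx !(map_mxB, map_mxM); apply: deform_comm.
  - by rewrite -!map_mxM Ecx.
  - by rewrite -!map_mxM Ecy.
  - by rewrite -map_mxM mulmxV // map_mx1.
rewrite det_mulmx detD_mx3 det_map_mx /pmx -map_mx_adj !det_map_mx det_crossmx add0r.
rewrite mulrC coefCM; congr (_ * _).
rewrite mulmxDr mxtraceD -scalemxAr mxtraceZ mulrDr !coefD -map_mxM trace_map_mx.
rewrite !(coefXM, coefXnM) /= coefC /= !addr0 adj_crossmx /S.
rewrite mulmxBr linearB /= trace_crossmx trace_crossmx; ring.
Qed.

Lemma deform_coef1 (k : 'rV[K]_3) : (x *m y - y *m x) *m B = crossmx k ->
  (forall i, (T (widen8 i))`_1 = 0) /\
  (T ord_max)`_1 = \det C *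
    ((k *m crossmx e *m (k *m y)^T) 0 0 - (k *m crossmx f *m (k *m x)^T) 0 0).
Proof.
move=> kE; have TE z i : (T i).[z] = trace_coords (P z) i by rewrite -deform_trace.
split=> [i|]; first by apply: even_coef1 => z; rewrite !TE; have [] := deform_even z.
have := deform_comm_coef1 kE; set U := \det (_ - _) => U1.
(* As U is t(5) at z minus t(5) at -z, this polynomial is their sum, which is even. *)
have : (T ord_max *+ 2 - U)`_1 = 0.
  apply: even_coef1 => z; have UE t : U.[t] = \det ((P t).1 *m (P t).2 - (P t).2 *m (P t).1).
    by rewrite -horner_evalE -det_map_mx map_mxB !map_mxM !map_dp.
  rewrite !(hornerD, hornerN, hornerMn) !UE !TE.
  have [_ <-] := deform_even z; have [_ <-] := deform_even (- z).
  by rewrite opprK; ring.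
rewrite coefB coefMn U1 => /eqP; rewrite subr_eq0 => /eqP E.
have n2 : (2 : K) != 0 by rewrite pnatr_eq0.
by apply: (mulfI n2); rewrite mulr_natl E; ring.
Qed.

End Deformation.

Lemma gradient_irreducible (K : numClosedFieldType) (P Q : {mpoly K[8]}) (x y : 'M[K]_3) :
  SL3 x -> SL3 y ->
  (forall rho, HomF2 rho -> (hypersurface_eqn P Q).@[trace_coords rho] = 0) ->
  (forall i, ((hypersurface_eqn P Q)^`M(i)).@[trace_coords (x, y)] = 0) ->
  reducible2 x y.
Proof.
move=> dx dy f0 df0; apply: contrapT => nred.
have nreig : ~ row_eig x y by move=> h; apply: nred; left.
(* The t(5)-derivative gives P = 2 t(5); the difference of f at the transposed pair and at (x, y) is
   then the square of the difference of the two values of t(5). *)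
have det0 : \det (x *m y - y *m x) = 0.
  have [hT Ew <-] := transpose_trace dx dy.
  have := f0 _ (conj dx dy : HomF2 (x, y)); have := f0 _ hT.
  have [Dmax _] := mderiv_hypersurface P Q (trace_coords (x, y)).
  have := df0 ord_max; rewrite Dmax => /eqP; rewrite subr_eq0 => /eqP EP.
  rewrite /hypersurface_eqn !(mevalD, mevalN, mevalM, rmorphXn) /= !meval_mwiden !mevalXU.
  rewrite !(meval_eq _ Ew) -EP => E' E; apply/eqP; rewrite -[_ == 0](@expf_eq0 _ _ 2) /=.
  by rewrite -[X in _ == X](subrr 0) -{1}E' -E; apply/eqP; ring.
have [k k0 kxy] : exists2 k : 'rV[K]_3, k != 0 & k *m (x *m y - y *m x) = 0.
  by apply/det0P; rewrite det0.
have [B B0 [Bs Bx By]] := symmetrizer_exists k0 kxy nreig.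
have uB := symmetrizer_unit B0 Bx By nred.
have uX : x *m B \in unitmx by rewrite unitmx_mul uB unitmxE dx unitr1.
have uY : y *m B \in unitmx by rewrite unitmx_mul uB unitmxE dy unitr1.
have Xs : (x *m B)^T = x *m B by rewrite trmx_mul Bs Bx.
have Ys : (y *m B)^T = y *m B by rewrite trmx_mul Bs By.
(* Moving B across transposes reverses the order of x and y, which makes this matrix skew. *)
have [c Ec] : exists c, (x *m y - y *m x) *m B = crossmx c.
  have As : ((x *m y - y *m x) *m B)^T = - ((x *m y - y *m x) *m B).
    rewrite trmx_mul linearB /= !trmx_mul Bs mulmxBr !mulmxA -By -Bx -!mulmxA -Bx -By.
    by rewrite mulmxBl opprB !mulmxA.
  exists (axial ((x *m y - y *m x) *m B)); rewrite crossmx_axial // => i.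
  have := congr1 (fun M : 'M[K]_3 => M i i) As.
  rewrite mxE [RHS]mxE => /eqP; rewrite -addr_eq0 -mulr2n mulrn_eq0 /=.
  by move/eqP.
have c0 : c != 0.
  apply/eqP=> c0; rewrite c0 crossmx0 in Ec; apply: nreig.
  have xy : x *m y = y *m x.
    by apply/eqP; rewrite -subr_eq0 -[_ - _](mulmxK uB) Ec mul0mx.
  by have [v v0 /andP[vx vy]] := @common_eigenvector2 _ 3 _ _ isT xy; exists v.
(* Such e and f define a line in SL_3 x SL_3 along which t(5) has nonzero derivative, against
   [singular_curve]. *)
suff [e [f [e0 f0' nz]]] : exists e f : 'rV[K]_3,
    [/\ (e *m (x *m B) *m e^T) 0 0 = 0, (f *m (y *m B) *m f^T) 0 0 = 0 &
      (c *m crossmx e *m (c *m y)^T) 0 0 - (c *m crossmx f *m (c *m x)^T) 0 0 != 0].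
  have [T1 Tmax] := deform_coef1 dx dy uB Bs Bx By e0 f0' Ec.
  have HT := deform_trace dx dy uB Bs Bx By e0 f0'.
  have /eqP : \det (invmx B) * ((c *m crossmx e *m (c *m y)^T) 0 0 -
      (c *m crossmx f *m (c *m x)^T) 0 0) = 0.
    rewrite -Tmax; apply: (singular_curve (P := P) (Q := Q)) T1 => [z|i].
      by rewrite (HT z) f0 //; exact: deform_HomF2.
    rewrite (HT 0) /deform.
    by rewrite !scale0r !addr0.
  rewrite mulf_eq0 (negbTE nz) orbF det_inv invr_eq0 => /eqP detB.
  by move: uB; rewrite unitmxE detB unitr0.
(* By [crossmx_dot] it suffices that e is not orthogonal to the cross product of c and cy, with f =
   0, or symmetrically. If both cross products vanish, c is a common eigenvector. *)
have [cy|cy] := eqVneq (cross c (c *m y)) 0; last first.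
  have [e [e0 ne]] := isotropic_off_line Xs uX cy.
  exists e, 0; split; [exact: e0 | by rewrite !mul0mx mxE |].
  by rewrite crossmx0 crossmx_dot mulmx0 mul0mx [X in _ - X]mxE subr0.
have [cx|cx] := eqVneq (cross c (c *m x)) 0; last first.
  have [f [f0' nf]] := isotropic_off_line Ys uY cx.
  exists 0, f; split; [by rewrite !mul0mx mxE | exact: f0' |].
  by rewrite crossmx0 crossmx_dot mulmx0 mul0mx [X in X - _]mxE sub0r oppr_eq0.
by case: nreig; exists c => //; split; apply: cross_eq0.
Qed.

(** * Reducible representations *)

Section Degeneration.
Variable K : numFieldType.
Implicit Types x y g : 'M[K]_3.

Lemma git_pi_conj g rho : SL3 g -> HomF2 rho -> git_pi (conj2 g rho) = git_pi rho.
Proof. by move=> dg hrho; apply: funext => p; exact: (svalP p). Qed.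

(** An invariant polynomial is constant along the curve for z nonzero, hence also at z = 0. *)
Lemma git_pi_limit rho (xp yp : 'M[{poly K}]_3) : HomF2 rho ->
  (forall z, z != 0 -> exists2 g, SL3 g &
     conj2 g rho = (map_mx (horner_eval z) xp, map_mx (horner_eval z) yp)) ->
  git_pi rho = git_pi (map_mx (horner_eval 0) xp, map_mx (horner_eval 0) yp).
Proof.
move=> hrho lim; apply: funext => -[p pinv]; rewrite /git_pi /=.
pose r := mmap polyC (fun i => row_mx (mxvec xp) (mxvec yp) 0 i) p.
have rE z : eval2 p (map_mx (horner_eval z) xp, map_mx (horner_eval z) yp) = r.[z].
  rewrite -meval_curve /eval2 /= -!map_mxvec -map_row_mx.
  by apply: meval_eq => i; rewrite mxE.
have r0 : r - (eval2 p rho)%:P = 0.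
  apply: (poly0_of_horner (r := 'X)); first by rewrite polyX_eq0.
  move=> z; rewrite hornerX => /lim[g dg Eg].
  by rewrite hornerD hornerN hornerC -rE -Eg pinv // subrr.
by rewrite rE -[r](subrK (eval2 p rho)%:P) r0 add0r hornerC.
Qed.

Lemma SL3_last_row (v : 'rV[K]_3) : v != 0 -> exists g, SL3 g /\ row o2 g = v.
Proof.
move=> v0; have [i vi] := row_neq0 v0; move: vi; rewrite [v]row3E.
move: (v 0 o0) (v 0 o1) (v 0 o2) => a b c; move: i; elim/ord3P; rewrite mxE /= => nz.
- exists (mx3 0 a^-1 0 0 0 1 a b c); split; last by apply: row3P; rewrite !mxE.
  by rewrite /SL3 /= det_mx3; field.
- exists (mx3 (- b^-1) 0 0 0 0 1 a b c); split; last by apply: row3P; rewrite !mxE.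
  by rewrite /SL3 /= det_mx3; field.
- exists (mx3 c^-1 0 0 0 1 0 a b c); split; last by apply: row3P; rewrite !mxE.
  by rewrite /SL3 /= det_mx3; field.
Qed.

Lemma SL3_unitmx g : SL3 g -> g \in unitmx.
Proof. by move=> dg; rewrite unitmxE dg unitr1. Qed.

(** The one-parameter subgroup commuting with [SL3_GL2]. It contracts off-block entries here and
    supplies the positive-dimensional stabilizers later. *)
Definition torus (z : K) := mx3 z 0 0 0 z 0 0 0 (z ^+ 2)^-1.

Lemma torus_SL3 z : z != 0 -> SL3 (torus z).
Proof. by move=> z0; rewrite /SL3 /torus /= det_mx3; field. Qed.

Lemma torus_inv z : z != 0 -> invmx (torus z) = torus z^-1.
Proof.
move=> z0; have dz := SL3_unitmx (torus_SL3 z0).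
rewrite -[RHS]mul1mx -(mulVmx dz) -mulmxA (_ : torus z *m _ = 1%:M) ?mulmx1 //.
by rewrite /torus mul_mx3 scalar_mx3; congr mx3; field.
Qed.

Lemma conj_SL3 g x : SL3 g -> SL3 x -> SL3 (g *m x *m invmx g).
Proof. by move=> dg dx; rewrite /SL3 /= !det_mulmx det_inv dg dx invr1 !mulr1. Qed.

Lemma row_eig_conj (v : 'rV[K]_3) g x : SL3 g -> SL3 x -> row o2 g = v -> stablemx v x ->
  exists a b c d p q, [/\ a * d - b * c != 0,
    g *m x *m invmx g = mx3 a b p c d q 0 0 (a * d - b * c)^-1 &
    SL3 (g *m x *m invmx g)].
Proof.
move=> dg dx gv /sub_rVP[k vx]; set h := _ *m _.
have dh : SL3 h by exact: conj_SL3.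
have hrow : row o2 h = k *: row o2 1%:M.
  by rewrite /h !row_mul gv vx -scalemxAl -gv -row_mul mulmxV ?SL3_unitmx.
have E j : h o2 j = k * (o2 == j)%:R.
  by have := congr1 (fun u : 'rV[K]_3 => u 0 j) hrow; rewrite !mxE.
have hE : h = mx3 (h o0 o0) (h o0 o1) (h o0 o2) (h o1 o0) (h o1 o1) (h o1 o2) 0 0 k.
  by rewrite [LHS]mx3E !E /= !mulr0 mulr1.
have := dh; rewrite /SL3 /= hE det_mx3 => dk.
have dk' : (h o0 o0 * h o1 o1 - h o0 o1 * h o1 o0) * k = 1 by rewrite -dk; ring.
have nz : h o0 o0 * h o1 o1 - h o0 o1 * h o1 o0 != 0.
  by apply/eqP=> z; move: dk'; rewrite z mul0r => /eqP; rewrite eq_sym oner_eq0.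
exists (h o0 o0), (h o0 o1), (h o1 o0), (h o1 o1), (h o0 o2), (h o1 o2); split=> //.
by congr mx3; rewrite -[LHS](mulKf nz) dk' mulr1.
Qed.

(** With the eigenvector as last basis row, conjugation by [torus z] multiplies the two entries
    above the last corner by z^3; let z tend to 0. *)
Lemma git_pi_block_row x y : SL3 x -> SL3 y -> row_eig x y ->
  exists x' y', [/\ SL3_GL2 x', SL3_GL2 y' & git_pi (x, y) = git_pi (x', y')].
Proof.
pose xp a b c d p q : 'M[{poly K}]_3 := mx3 a%:P b%:P (p *: 'X^3) c%:P d%:P (q *: 'X^3)
   0 0 ((a * d - b * c)^-1)%:P.
have xpE z (a b c d p q : K) : map_mx (horner_eval z) (xp a b c d p q) =
  mx3 a b (p * z ^+ 3) c d (q * z ^+ 3) 0 0 (a * d - b * c)^-1.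
  by apply: mx3P; rewrite !mxE /= /horner_eval ?hornerZ ?hornerXn ?hornerC ?horner0.
move=> dx dy [v v0 [vx vy]]; have [g [dg gv]] := SL3_last_row v0.
have [a [b [c [d [p [q [nx Ex dx']]]]]]] := row_eig_conj dg dx gv vx.
have [a' [b' [c' [d' [p' [q' [ny Ey dy']]]]]]] := row_eig_conj dg dy gv vy.
exists (mx3 a b 0 c d 0 0 0 (a * d - b * c)^-1),
  (mx3 a' b' 0 c' d' 0 0 0 (a' * d' - b' * c')^-1); split.
- by apply/SL3_GL2P; exists a, b, c, d.
- by apply/SL3_GL2P; exists a', b', c', d'.
rewrite -(git_pi_conj (rho := (x, y)) dg) // /conj2 /=.
have -> := @git_pi_limit (g *m x *m invmx g, g *m y *m invmx g)
  (xp a b c d p q) (xp a' b' c' d' p' q').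
- by rewrite !xpE expr0n /= !mulr0.
- by split.
move=> z z0; exists (torus z); first exact: torus_SL3.
rewrite !xpE Ex Ey /conj2 /= torus_inv // /torus !mul_mx3.
by congr (_, _); congr mx3; field; rewrite ?z0 ?nx ?ny.
Qed.

(** The transposed situation, brought to block form by the inverse transpose of g. *)
Lemma git_pi_block_col x y : SL3 x -> SL3 y -> row_eig x^T y^T ->
  exists x' y', [/\ SL3_GL2 x', SL3_GL2 y' & git_pi (x, y) = git_pi (x', y')].
Proof.
pose xp a b c d p q : 'M[{poly K}]_3 := mx3 a%:P b%:P 0 c%:P d%:P 0
   (p *: 'X^3) (q *: 'X^3) ((a * d - b * c)^-1)%:P.
have xpE z (a b c d p q : K) : map_mx (horner_eval z) (xp a b c d p q) =
  mx3 a b 0 c d 0 (p * z ^+ 3) (q * z ^+ 3) (a * d - b * c)^-1.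
  by apply: mx3P; rewrite !mxE /= /horner_eval ?hornerZ ?hornerXn ?hornerC ?horner0.
move=> dx dy [v v0 [vx vy]]; have [g [dg gv]] := SL3_last_row v0.
have [dx' dy'] : SL3 x^T /\ SL3 y^T by rewrite /SL3 /= !det_tr.
have [a [b [c [d [p [q [nx Ex _]]]]]]] := row_eig_conj dg dx' gv vx.
have [a' [b' [c' [d' [p' [q' [ny Ey _]]]]]]] := row_eig_conj dg dy' gv vy.
have dh : SL3 (invmx g^T) by rewrite /SL3 /= det_inv det_tr dg invr1.
have trE A : invmx g^T *m A *m invmx (invmx g^T) = (g *m A^T *m invmx g)^T.
  by rewrite !trmx_mul trmxK trmx_inv invmxK mulmxA.
exists (mx3 a c 0 b d 0 0 0 (a * d - c * b)^-1),
  (mx3 a' c' 0 b' d' 0 0 0 (a' * d' - c' * b')^-1); split.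
- by apply/SL3_GL2P; exists a, c, b, d; rewrite [c * b]mulrC.
- by apply/SL3_GL2P; exists a', c', b', d'; rewrite [c' * b']mulrC.
rewrite -(git_pi_conj (rho := (x, y)) dh) // /conj2 /=.
have -> := @git_pi_limit (invmx g^T *m x *m invmx (invmx g^T), invmx g^T *m y *m invmx (invmx g^T))
  (xp a c b d p q) (xp a' c' b' d' p' q').
- by rewrite !xpE expr0n /= !mulr0.
- by split; apply: conj_SL3.
move=> z z0; have z0' : z^-1 != 0 by rewrite invr_eq0.
(* The entries to contract now lie in the last row, so the inverse torus element scales them by
   z^3. *)
exists (torus z^-1); first exact: torus_SL3.
rewrite !xpE /conj2 /= !trE Ex Ey torus_inv // invrK /torus !tr_mx3 !mul_mx3.
by rewrite ![_ * b]mulrC ![_ * b']mulrC; congr (_, _); congr mx3; field; rewrite ?z0 ?nx ?ny.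
Qed.

Lemma git_pi_reducible x y : SL3 x -> SL3 y -> reducible2 x y ->
  exists x' y', [/\ SL3_GL2 x', SL3_GL2 y' & git_pi (x, y) = git_pi (x', y')].
Proof. by move=> dx dy []; [exact: git_pi_block_row | exact: git_pi_block_col]. Qed.

End Degeneration.

(** * Stabilizers *)

Section Zariski.
Variables (K : numFieldType) (n : nat).

Lemma zariski_closed1 (v : 'rV[K]_n) : zariski_closed [set v].
Proof.
exists [set p | exists i, p = 'X_i - (v 0 i)%:MP]; apply/seteqP; split=> [_ -> p [i ->]|w Hw] /=.
  by rewrite mevalB mevalXU mevalC subrr.
apply/rowP=> i; apply/eqP; rewrite -subr_eq0; apply/eqP.
by have /= := Hw _ (ex_intro _ i erefl); rewrite mevalB mevalXU mevalC.
Qed.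

Lemma irreducible_closed1 (v : 'rV[K]_n) : irreducible_closed [set v].
Proof.
split; [exact: zariski_closed1 | by exists v | move=> Z1 Z2 _ _ sub].
by have [h|h] := sub v erefl; [left | right] => _ ->.
Qed.

(** Pulled back along h and cleared of denominators, polynomials become one-variable polynomials,
    and a product of two nonzero ones is nonzero. *)
Lemma irreducible_closed_laurent (q : 'I_n -> {poly K}) k :
  let h z : 'rV[K]_n := \row_i (z ^- k * (q i).[z]) in
  zariski_closed (h @` [set z | z != 0]) -> irreducible_closed (h @` [set z | z != 0]).
Proof.
move=> h hcl; split=> //; first by exists (h 1), 1 => //=; exact: oner_neq0.
have clear p : exists N (P : {poly K}), forall z, z != 0 -> P.[z] = z ^+ N * p.@[h z 0].
  elim/mpoly_ring_ind: p => [c|i|p p' [N [P HP]] [N' [P' HP']]|p p' [N [P HP]] [N' [P' HP']]].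
  - by exists 0, c%:P => z _; rewrite hornerC mevalC expr0 mul1r.
  - exists k, (q i) => z z0; rewrite mevalXU mxE mulrA mulfV ?mul1r //.
    by rewrite expf_neq0.
  - exists (N + N')%N, ('X^N' * P + 'X^N * P') => z z0.
    by rewrite hornerD !hornerM !hornerXn HP // HP' // mevalD exprD; ring.
  - exists (N + N')%N, (P * P') => z z0.
    by rewrite hornerM HP // HP' // mevalM exprD; ring.
move=> _ _ [I1 ->] [I2 ->] sub; apply: contrapT => /not_orP[/= no1 no2].
have wit (I : set {mpoly K[n]}) :
    ~ (h @` [set z | z != 0] `<=` [set v | forall p, I p -> p.@[v 0] = 0]) ->
    exists p z, [/\ I p, z != 0 & p.@[h z 0] != 0].
  move=> no; apply: contrapT => none; apply: no => _ [z z0 <-] p Ip.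
  by apply/eqP; apply: contrapT => /negP nz; apply: none; exists p, z.
have [p1 [z1 [I1p1 z10 nz1]]] := wit _ no1.
have [p2 [z2 [I2p2 z20 nz2]]] := wit _ no2.
have [N1 [P1 HP1]] := clear p1; have [N2 [P2 HP2]] := clear p2.
have : P1 * P2 = 0.
  apply: (poly0_of_horner (r := 'X)); first by rewrite polyX_eq0.
  move=> z; rewrite hornerX => z0; rewrite hornerM HP1 // HP2 //.
  have [|/(_ _ I1p1) ->|/(_ _ I2p2) ->] := sub (h z); first by exists z.
    by rewrite mulr0 mul0r.
  by rewrite !mulr0.
move/eqP; rewrite mulf_eq0 => /orP[]/eqP P0.
  have := HP1 _ z10; rewrite P0 horner0 => /esym/eqP.
  by rewrite mulf_eq0 expf_eq0 (negbTE z10) andbF (negbTE nz1).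
have := HP2 _ z20; rewrite P0 horner0 => /esym/eqP.
by rewrite mulf_eq0 expf_eq0 (negbTE z20) andbF (negbTE nz2).
Qed.

End Zariski.

Section Stabilizer.
Variable K : numClosedFieldType.
Implicit Types (x y g : 'M[K]_3).

Lemma stabilizer_commute g x : SL3 g -> g *m x *m invmx g = x -> g *m x = x *m g.
Proof. by move=> dg E; rewrite -[in RHS]E mulmxKV ?SL3_unitmx. Qed.

(** Schur's lemma: an eigenspace of g is stable under x and y, hence is everything. *)
Lemma stabilizer_irreducible x y g : ~ reducible2 x y -> stabilizer (x, y) g ->
  exists2 a, a ^+ 3 = 1 & g = a%:M.
Proof.
move=> nred [dg [/stabilizer_commute cx /stabilizer_commute cy]].
have {cx} cx := cx dg; have {cy} cy := cy dg.
have [a ga] := eigenvalue_closed g (isT : (0 < 3)%N).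
have gE : g = a%:M.
  have : \rank (eigenspace g a) = 3.
    apply/eqP; rewrite eqn_leq rank_leq_row leqNgt; apply/negP=> lt; apply: nred.
    apply: (@stable_reducible _ _ (eigenspace g a)).
    - by rewrite lt andbT lt0n mxrank_eq0.
    - exact: comm_mx_stable_eigenspace.
    - exact: comm_mx_stable_eigenspace.
  move/eqP; rewrite -[_ == _]/(row_full _) => full.
  have /eigenspaceP : (1%:M <= eigenspace g a)%MS by exact: submx_full.
  by rewrite mul1mx scalemx1.
exists a => //; move: dg; rewrite gE /SL3 /= det_scalar //.
Qed.

(** The stabilizer consists of scalar cube roots of unity, so an irreducible closed subset cannot
    strictly contain another. *)
Lemma not_positive_dimensional x y : ~ reducible2 x y ->
  ~ positive_dimensional (mxvec @` stabilizer (x, y)).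
Proof.
move=> nred [Z [Zs Zlt]].
have [[_ [v Z0v] _] _] := Zs 0 isT; have [[_ _ irr] Z1S] := Zs 1 isT.
have [Z01 nZ10] := Zlt 0 isT.
have scal u : Z 1%N u -> exists2 a, a ^+ 3 = 1 & u = mxvec a%:M.
  by move=> /Z1S[g /(stabilizer_irreducible nred)[a a3 ->] <-]; exists a.
have [b b3 vE] := scal v (Z01 _ Z0v).
have b0 : b != 0 by apply/eqP=> b0; move/eqP: b3; rewrite b0 expr0n eq_sym oner_eq0.
pose i0 := mxvec_index o0 o0; have i0E a : (mxvec (a%:M : 'M[K]_3)) 0 i0 = a.
  by rewrite mxvecE mxE.
(* For a scalar point b of the smaller set, the factors a - b and a^2 + ab + b^2 of a^3 - b^3 = 0
   cover the larger set by two closed sets. *)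
pose F1 := [set u : 'rV[K]_(3 * 3) | forall p, p = 'X_i0 - b%:MP -> p.@[u 0] = 0].
pose F2 := [set u : 'rV[K]_(3 * 3) |
  forall p, p = 'X_i0 * 'X_i0 + b%:MP * 'X_i0 + (b * b)%:MP -> p.@[u 0] = 0].
have F1E u : F1 u <-> u 0 i0 = b.
  split=> [/(_ _ erefl)|uE p ->]; rewrite mevalB mevalXU mevalC.
    by move/eqP; rewrite subr_eq0 => /eqP.
  by rewrite uE subrr.
have F2E u : F2 u <-> u 0 i0 * u 0 i0 + b * u 0 i0 + b * b = 0.
  by split=> [/(_ _ erefl)|uE p ->]; rewrite !mevalD !mevalM mevalXU !mevalC.
have [|||sub1|sub2] := irr F1 F2.
- by exists [set p | p = 'X_i0 - b%:MP].
- by exists [set p | p = 'X_i0 * 'X_i0 + b%:MP * 'X_i0 + (b * b)%:MP].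
- move=> u /scal[a a3 ->]; rewrite /= F1E F2E i0E.
  have /eqP : (a - b) * (a * a + b * a + b * b) = a ^+ 3 - b ^+ 3 by ring.
  rewrite a3 b3 subrr mulf_eq0 subr_eq0 => /orP[/eqP|/eqP]; [by left | by right].
- apply: nZ10 => u Z1u; have /F1E := sub1 _ Z1u.
  by have [a _ ->] := scal u Z1u; rewrite i0E => ->; rewrite -vE.
(* At a = b the second factor is 3 b^2, which is nonzero. *)
have /F2E := sub2 _ (Z01 _ Z0v); rewrite vE i0E -!mulr2n -mulrSr => /eqP.
by rewrite mulrn_eq0 mulf_eq0 (negbTE b0).
Qed.

(** The conjugated torus fixes the pair; the identity inside this torus is the chain of length
    one. *)
Lemma positive_dimensional_block g x y : SL3 g -> SL3_GL2 x -> SL3_GL2 y ->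
  positive_dimensional (mxvec @` stabilizer (conj2 g (x, y))).
Proof.
move=> dg hx hy; have ug := SL3_unitmx dg.
pose m z := g *m torus z *m invmx g.
have mSL z : z != 0 -> SL3 (m z) by move=> z0; apply: conj_SL3 => //; apply: torus_SL3.
have mstab z : z != 0 -> stabilizer (conj2 g (x, y)) (m z).
  move=> z0; have comm A : SL3_GL2 A ->
      m z *m (g *m A *m invmx g) *m invmx (m z) = g *m A *m invmx g.
    move=> /SL3_GL2P[a [b [c [d [_ ->]]]]].
    rewrite -[RHS](mulmxK (SL3_unitmx (mSL _ z0))); congr (_ *m _).
    rewrite /m !mulmxA !(mulmxKV ug) -!(mulmxA g); congr (_ *m (_ *m _)).
    by rewrite /torus !mul_mx3; congr mx3; ring.
  by split; [exact: mSL | rewrite /conj2 /= !comm].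
(* z^2 times [torus z] has polynomial entries, so the torus is a Laurent curve with k = 2. *)
pose M : 'M[{poly K}]_3 := map_mx polyC g *m
   mx3 'X^3 0 0 0 'X^3 0 0 0 1 *m map_mx polyC (invmx g).
pose q i := mxvec M 0 i; pose h z := \row_i (z ^- 2 * (q i).[z]).
have polyK z (A : 'M[K]_3) : map_mx (horner_eval z) (map_mx polyC A) = A.
  by apply/matrixP=> i j; rewrite !mxE /= /horner_eval hornerC.
have hE z : z != 0 -> h z = mxvec (m z).
  move=> z0; apply/rowP=> i; rewrite [LHS]mxE.
  have -> : (q i).[z] = map_mx (horner_eval z) (mxvec M) 0 i by rewrite mxE.
  rewrite map_mxvec !map_mxM !polyK.
  rewrite (_ : map_mx _ _ = mx3 (z ^+ 3) 0 0 0 (z ^+ 3) 0 0 0 1); last first.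
    by apply: mx3P; rewrite !mxE /= /horner_eval ?hornerXn ?horner0 ?hornerC.
  rewrite /m (_ : torus z = z ^- 2 *: mx3 (z ^+ 3) 0 0 0 (z ^+ 3) 0 0 0 1); last first.
    by rewrite scale_mx3 /torus; congr mx3; field.
  by rewrite -scalemxAr -scalemxAl linearZ mxE.
have hcl : zariski_closed (h @` [set z | z != 0]).
  pose N : 'M[{mpoly K[3 * 3]}]_3 := map_mx (@mpolyC _ K) (invmx g) *m
    vec_mx (\row_i 'X_i) *m map_mx (@mpolyC _ K) g.
  have NE (v : 'rV[K]_(3 * 3)) : map_mx (meval (v 0)) N = invmx g *m vec_mx v *m g.
    have mpolyK (A : 'M[K]_3) : map_mx (meval (v 0)) (map_mx (@mpolyC _ K) A) = A.
      by apply/matrixP=> i j; rewrite !mxE /= mevalC.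
    rewrite !map_mxM !mpolyK map_vec_mx; congr (_ *m vec_mx _ *m _).
    by apply/rowP=> i; rewrite !mxE /= mevalXU.
  (* After conjugating back, the torus is cut out by diagonality, equality of the first two diagonal
     entries and determinant 1. *)
  exists [set p | p \in [:: N o0 o1; N o0 o2; N o1 o0; N o1 o2; N o2 o0; N o2 o1;
     N o0 o0 - N o1 o1; N o0 o0 * N o0 o0 * N o2 o2 - 1]].
  have NE' (v : 'rV[K]_(3 * 3)) i j : (N i j).@[v 0] = (invmx g *m vec_mx v *m g) i j.
    by rewrite -NE [RHS]mxE.
  apply/seteqP; split=> [_ [z /= z0 <-] p|v /= Hv].
    rewrite hE //; have {}NE' i j : (N i j).@[mxvec (m z) 0] = torus z i j.
      by rewrite NE' mxvecK /m !mulmxA mulmxKV // mulVmx // mul1mx.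
    rewrite !inE => Hp; repeat case/predU1P: Hp => [->|Hp];
      rewrite ?NE' ?mevalB ?mevalM ?meval1 ?NE' ?mxE ?subrr //.
    by move/eqP: Hp => ->; rewrite mevalB !mevalM meval1 !NE' !mxE /=; field.
  have : all (fun p => p.@[v 0] == 0) [:: N o0 o1; N o0 o2; N o1 o0; N o1 o2; N o2 o0; N o2 o1;
     N o0 o0 - N o1 o1; N o0 o0 * N o0 o0 * N o2 o2 - 1].
    by apply/allP => p /Hv /eqP.
  rewrite /= !mevalB !mevalM meval1 !NE' andbT; set A := invmx g *m vec_mx v *m g.
  case/and5P=> /eqP A01 /eqP A02 /eqP A10 /eqP A12 /and4P[/eqP A20 /eqP A21 /eqP d1 /eqP d2].
  have AE : A = mx3 (A o0 o0) 0 0 0 (A o0 o0) 0 0 0 (A o2 o2).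
    by apply: mx3P; rewrite [RHS]mxE //=; apply/eqP; rewrite eq_sym -subr_eq0 d1.
  have a0 : A o0 o0 != 0.
    by apply/eqP=> a0; move/eqP: d2; rewrite a0 !mul0r sub0r oppr_eq0 oner_eq0.
  exists (A o0 o0) => //; rewrite hE // /m /torus.
  have -> : (A o0 o0 ^+ 2)^-1 = A o2 o2.
    apply: (mulfI (expf_neq0 2 a0)); rewrite mulfV ?expf_neq0 //.
    by apply/eqP; rewrite eq_sym -subr_eq0 expr2 d2.
  by rewrite -AE /A !mulmxA mulmxK // mulmxV // mul1mx vec_mxK.
have hS : h @` [set z | z != 0] `<=` mxvec @` stabilizer (conj2 g (x, y)).
  by move=> _ [z /= z0 <-]; exists (m z); [exact: mstab | rewrite hE].
have h1 : (h @` [set z | z != 0]) (mxvec 1%:M).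
  exists 1; rewrite /= ?oner_neq0 // hE ?oner_neq0 // /m.
  have -> : torus 1 = 1%:M :> 'M[K]_3 by rewrite /torus scalar_mx3 expr1n invr1.
  by rewrite mulmx1 mulmxV.
exists (fun i => if i is 0 then [set mxvec 1%:M] else h @` [set z | z != 0]); split.
  case=> [_|i _]; last by split=> //; apply: irreducible_closed_laurent.
  split; first exact: irreducible_closed1.
  by move=> _ ->; apply: hS.
case=> // _; split=> [_ -> //|sub].
(* The inclusion is strict because [torus (-1)] is not the identity. *)
have n10 : (-1 : K) != 0 by rewrite oppr_eq0 oner_neq0.
have /sub : (h @` [set z | z != 0]) (mxvec (m (-1))) by exists (-1); rewrite ?hE.
move=> /(can_inj mxvecK); rewrite /m => E.
have := congr1 (fun A => invmx g *m A *m g) E.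
rewrite mulmx1 mulVmx // !mulmxA mulmxKV // mulVmx // mul1mx.
move=> /(congr1 (fun A : 'M[K]_3 => A o0 o0)); rewrite !mxE /= => /eqP.
by rewrite eq_sym -subr_eq0 opprK -mulr2n mulrn_eq0 /= oner_eq0.
Qed.

End Stabilizer.

(** * Completely reducible representations *)

Section CompletelyReducible.
Variable K : numFieldType.
Implicit Types (x y : 'M[K]_3).

Lemma eigen_inv x (k : K) (v : 'cV[K]_3) : SL3 x -> v != 0 -> x *m v = k *: v ->
  invmx x *m v = k^-1 *: v.
Proof.
move=> dx v0 xv; have ux := SL3_unitmx dx.
have k0 : k != 0.
  by apply: contraNneq v0 => k0; rewrite -[v](mulKmx ux) xv k0 scale0r mulmx0.
by rewrite -[v in LHS](scalerK k0) -xv -scalemxAr mulKmx.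
Qed.

Lemma eigen_inv_row x (k : K) (v : 'rV[K]_3) : SL3 x -> v != 0 -> v *m x = k *: v ->
  v *m invmx x = k^-1 *: v.
Proof.
move=> dx v0 xv; apply: trmx_inj; rewrite trmx_mul trmx_inv linearZ /=.
by apply: eigen_inv; rewrite ?trmx_eq0 // -?trmx_mul ?xv ?linearZ // /SL3 /= det_tr.
Qed.

(** A common left eigenvector has an invariant plane as kernel, and a common right eigenvector spans
    an invariant line. *)
Lemma irreducible_not_reducible2 x y : SL3 x -> SL3 y ->
  irreducible_subspace (x, y) fullv -> ~ reducible2 x y.
Proof.
move=> dx dy [_ _ irr] [] [v v0 [/sub_rVP[k vx] /sub_rVP[l vy]]].
- pose W := lker (linfun (mulmx v : 'cV[K]_3 -> 'cV[K]_1)).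
  have WE w : (w \in W) = (v *m w == 0) by rewrite memv_ker lfunE.
  have [||W0|W1] := irr W; rewrite ?subvf //.
  + have st A a : v *m A = a *: v -> forall w, w \in W -> A *m w \in W.
      move=> vA w; rewrite !WE => /eqP vw.
      by rewrite mulmxA vA -scalemxAl vw scaler0.
    by move=> w wW; split=> /=; apply: (st _ _ _ _ wW);
      [exact: vx | exact: (eigen_inv_row dx v0 vx) | exact: vy | exact: (eigen_inv_row dy v0 vy)].
  + pose w := (nz_row (kermx v^T))^T.
    have : w \in W.
      by rewrite WE -[v]trmxK -trmx_mul (sub_kermxP (nz_row_sub _)) trmx0.
    rewrite W0 memv0 trmx_eq0 nz_row_eq0 -mxrank_eq0 mxrank_ker mxrank_tr rank_rV v0.
    by [].
  + have [i vi] := row_neq0 v0; have : (delta_mx i 0 : 'cV[K]_3) \in W by rewrite W1 memvf.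
    by rewrite WE -colE => /eqP/matrixP/(_ 0 0); rewrite !mxE => /eqP; rewrite (negbTE vi).
have v0' : v^T != 0 by rewrite trmx_eq0.
have ev A a : v *m A^T = a *: v -> A *m v^T = a *: v^T.
  by move=> E; apply: trmx_inj; rewrite trmx_mul trmxK E linearZ /= trmxK.
have {}vx := ev _ _ vx; have {}vy := ev _ _ vy.
have [||W0|W1] := irr <[v^T]>%VS; rewrite ?subvf //.
- have st A a : A *m v^T = a *: v^T -> forall w, w \in <[v^T]>%VS -> A *m w \in <[v^T]>%VS.
    move=> vA _ /vlineP[b ->]; rewrite -scalemxAr vA !memvZ ?memv_line //.
  by move=> w wW; split=> /=; apply: (st _ _ _ _ wW);
     [exact: vx | exact: (eigen_inv dx v0' vx) | exact: vy | exact: (eigen_inv dy v0' vy)].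
- by have := memv_line v^T; rewrite W0 memv0 (negbTE v0').
by have := dim_vline v^T; rewrite W1 dimvf v0' /dim /=.
Qed.

Lemma vspace_dim1 (vT : vectType K) (U : {vspace vT}) : \dim U = 1 ->
  exists v, forall u, u \in U -> exists a, u = a *: v.
Proof.
move=> dU; have E := span_basis (vbasisP U).
move: (vbasis U) E => [s /= /eqP]; rewrite dU; case: s => [|v [|//]] //= _ E.
by exists v => u; rewrite -E span_seq1 => /vlineP.
Qed.

Lemma vspace_dim2 (vT : vectType K) (U : {vspace vT}) : \dim U = 2 ->
  exists v w, [/\ v \in U, w \in U & forall u, u \in U -> exists a b, u = a *: v + b *: w].
Proof.
move=> dU; have E := span_basis (vbasisP U).
move: (vbasis U) E => [s /= /eqP]; rewrite dU; case: s => [|v [|w [|//]]] //= _ E.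
exists v, w; rewrite -E; split; rewrite ?memv_span ?inE ?eqxx ?orbT //.
move=> u; rewrite span_cons span_seq1 => /memv_addP[_ /vlineP[a ->] [_ /vlineP[b ->] ->]].
by exists a, b.
Qed.

Definition cols3 (u v w : 'cV[K]_3) : 'M[K]_3 := \matrix_(i, j) nth 0 [:: u; v; w] j i 0.

Lemma mul_cols3 A u v w : A *m cols3 u v w = cols3 (A *m u) (A *m v) (A *m w).
Proof.
by apply/matrixP=> i; elim/ord3P; rewrite !mxE; apply: eq_bigr => j _; rewrite mxE.
Qed.

Lemma cols3_mul u v w (a b c d k : K) :
  cols3 u v w *m mx3 a b 0 c d 0 0 0 k =
  cols3 (a *: u + c *: v) (b *: u + d *: v) (k *: w).
Proof.
by apply/matrixP=> i; elim/ord3P; rewrite !mxE sum3 !mxE /=; ring.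
Qed.

Lemma cols3_mulv u v w (t : 'cV[K]_3) :
  cols3 u v w *m t = t o0 0 *: u + t o1 0 *: v + t o2 0 *: w.
Proof. by apply/matrixP=> i j; rewrite !ord1 !mxE sum3 !mxE /=; ring. Qed.

Lemma det_cols3Z u v w (k : K) : \det (cols3 u v (k *: w)) = k * \det (cols3 u v w).
Proof. by rewrite !det3 !mxE /=; ring. Qed.

(** In a basis made of a basis of the plane followed by a vector of the line, both matrices are
    block diagonal. *)
Lemma plane_line_conj x y (U W : {vspace 'cV[K]_3}) : SL3 x -> SL3 y ->
  invariant_subspace (x, y) U -> invariant_subspace (x, y) W ->
  \dim U = 1 -> \dim W = 2 -> (U + W)%VS = fullv ->
  exists g x' y', [/\ SL3 g, SL3_GL2 x', SL3_GL2 y' & (x, y) = conj2 g (x', y')].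
Proof.
move=> dx dy Ui Wi dU dW UW; have [v Uv] := vspace_dim1 dU.
have U0 : U != 0%VS by rewrite -dimv_eq0 dU.
pose v1 := vpick U; have v1U : v1 \in U by exact: memv_pick.
have v10 : v1 != 0 by rewrite vpick0.
have [c v1E] := Uv _ v1U.
have c0 : c != 0 by apply: contraNneq v10 => c0; rewrite v1E c0 scale0r.
have {}Uv u : u \in U -> exists a, u = a *: v1.
  by move=> /Uv[a ->]; exists (a / c); rewrite v1E scalerA divfK.
have [w1 [w2 [w1W w2W Wv]]] := vspace_dim2 dW.
pose g0 := cols3 w1 w2 v1.
have onto (t : 'cV[K]_3) : exists s, g0 *m s = t.
  have : t \in (U + W)%VS by rewrite UW memvf.
  move=> /memv_addP[_ /Uv[a ->] [_ /Wv[b [d ->]] ->]].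
  exists (\col_i nth 0 [:: b; d; a] i).
  by rewrite cols3_mulv !mxE /= addrC.
have ug0 : g0 \in unitmx.
  have [s0 E0] := onto (delta_mx o0 0); have [s1 E1] := onto (delta_mx o1 0).
  have [s2 E2] := onto (delta_mx o2 0).
  have /mulmx1_unit[] // : g0 *m cols3 s0 s1 s2 = 1%:M.
  rewrite mul_cols3 E0 E1 E2; apply/matrixP=> i; elim/ord3P; rewrite !mxE /= andbT //.
have dg0 : \det g0 != 0 by rewrite -unitfE -unitmxE.
(* Rescaling the vector of the line normalizes the determinant of the change of basis. *)
pose g := cols3 w1 w2 ((\det g0)^-1 *: v1).
have dg : SL3 g by rewrite /SL3 /= det_cols3Z mulVf.
have block A : SL3 A -> (forall u, u \in U -> A *m u \in U) ->
    (forall u, u \in W -> A *m u \in W) ->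
    exists2 A', SL3_GL2 A' & A = g *m A' *m invmx g.
  move=> dA AU AW; have [k Ek] := Uv _ (AU _ v1U).
  have [a [b E1]] := Wv _ (AW _ w1W); have [a' [b' E2]] := Wv _ (AW _ w2W).
  pose A' := mx3 a a' 0 b b' 0 0 0 k.
  have AE : A *m g = g *m A'.
    rewrite mul_cols3 cols3_mul E1 E2 -scalemxAr Ek !scalerA [k * _]mulrC //.
  have dA' : (a * b' - a' * b) * k = 1.
    have := congr1 determinant AE; rewrite !det_mulmx dA dg mul1r det_mx3 => ->.
    by ring.
  have nz : a * b' - a' * b != 0.
    by apply/eqP=> z; move/eqP: dA'; rewrite z mul0r eq_sym oner_eq0.
  exists A'; last by rewrite -AE mulmxK // SL3_unitmx.
  apply/SL3_GL2P; exists a, a', b, b'; split=> //; congr mx3.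
  by rewrite -[LHS](mulKf nz) dA' mulr1.
have [x' hx' xE] : exists2 x', SL3_GL2 x' & x = g *m x' *m invmx g.
  by apply: block => // u uS; [have [] := Ui u uS | have [] := Wi u uS].
have [y' hy' yE] : exists2 y', SL3_GL2 y' & y = g *m y' *m invmx g.
  by apply: block => // u uS; [have [] := Ui u uS | have [] := Wi u uS].
by exists g, x', y'; split=> //; rewrite /conj2 /= -xE -yE.
Qed.

Lemma invariant_sum (rho : 'M[K]_3 * 'M[K]_3) (I : finType) (P : pred I)
    (U : I -> {vspace 'cV[K]_3}) :
  (forall i, P i -> invariant_subspace rho (U i)) ->
  invariant_subspace rho (\sum_(i | P i) U i)%VS.
Proof.
move=> Ui _ /memv_sumP[u uU ->]; rewrite !mulmx_sumr.
by split; apply: memv_sumr => i Pi; have [] := Ui i Pi _ (uU i Pi).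
Qed.

(** With at least two summands of total dimension 3, one is a line, and the others add up to an
    invariant plane. *)
Lemma completely_reducible_cases x y : SL3 x -> SL3 y -> completely_reducible (x, y) ->
  irreducible_subspace (x, y) fullv \/
  exists g x' y', [/\ SL3 g, SL3_GL2 x', SL3_GL2 y' & (x, y) = conj2 g (x', y')].
Proof.
move=> dx dy [n [U [Uirr Udir Usum]]].
have dimU : (\sum_(i < n) \dim (U i) = 3)%N.
  by rewrite -(directvP Udir) /= Usum dimvf.
have U0 i : (0 < \dim (U i))%N.
  by have [_ /eqP + _] := Uirr i; rewrite -dimv_eq0 lt0n.
case: n => [|[|n]] in U Uirr Udir Usum dimU U0 *.
- by rewrite big_ord0 in dimU.
- by left; move: Usum; rewrite big_ord1 => <-; exact: Uirr.
(* Otherwise n + 2 summands of dimension at least 2 would give total dimension at least 4. *)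
right; have [i Ui1] : exists i, \dim (U i) = 1%N.
  apply: contrapT => none; have : (\sum_(i < n.+2) 2 <= \sum_(i < n.+2) \dim (U i))%N.
    apply: leq_sum => i _; rewrite ltn_neqAle U0 andbT eq_sym.
    by apply/eqP => di; apply: none; exists i.
  by rewrite dimU sum_nat_const card_ord.
have UW : (U i + \sum_(j | j != i) U j)%VS = fullv by rewrite -Usum [RHS](bigD1 i).
apply: (plane_line_conj dx dy (U := U i) (W := (\sum_(j | j != i) U j)%VS)) => //.
- by have [] := Uirr i.
- by apply: invariant_sum => j _; have [] := Uirr j.
have := directv_sumP Udir i isT; rewrite /= => /dimv_disjoint_sum.
by rewrite UW dimvf Ui1 add1n => E; apply: succn_inj; rewrite -E.
Qed.

End CompletelyReducible.

(** * Singular points and reducibility *)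

Lemma singular_SL3_GL2 (K : numClosedFieldType) (x y : 'M[K]_3) :
  SL3_GL2 x -> SL3_GL2 y -> singular_locus (git_pi (x, y)).
Proof.
move=> hx hy; exists (x, y) => //; split; first by split; exact: SL3_GL2_SL3.
exists (Ppoly K), (Qpoly K); split=> [|i]; last exact: gradient_SL3_GL2.
apply: hypersurface_generates; first exact: hypersurface_PQ_trace.
by move=> *; exact: tr_comm_Ppoly.
Qed.

(** The representative witnessing singularity may be another pair, but the trace coordinates agree,
    so the gradient also vanishes at (x, y). *)
Lemma singular_reducible (K : numClosedFieldType) (x y : 'M[K]_3) :
  SL3 x -> SL3 y -> singular_locus (git_pi (x, y)) -> reducible2 x y.
Proof.
move=> dx dy [rho [hrho [P [Q [gen grad]]]] Erho].
(* f is in the ideal it generates, so it vanishes on all trace coordinates. *)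
have f0 := (gen (hypersurface_eqn P Q)).2 (ex_intro _ 1 (esym (mul1r _))).
apply: (gradient_irreducible dx dy f0) => i.
by rewrite -(trace_coords_git_pi hrho (conj dx dy : HomF2 (x, y)) Erho); exact: grad.
Qed.

Theorem theorem9 (R : realType) :
  (forall rho : 'M[R[i]]_3 * 'M[R[i]]_3,
     HomF2 rho -> completely_reducible rho ->
     (singular_locus (git_pi rho) <->
      positive_dimensional (mxvec @` stabilizer rho)))
  /\ @singular_locus R[i] = git_image (@SL3_GL2 R[i]).
Proof.
split=> [[x y] [dx dy] cr|].
  (* In the irreducible case both conditions fail; in the block diagonal case both hold. *)
  have [irr|[g [x' [y' [dg hx hy E]]]]] := completely_reducible_cases dx dy cr.
    have nred := irreducible_not_reducible2 dx dy irr.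
    split=> [/(singular_reducible dx dy)//|].
    by move/(not_positive_dimensional nred).
  rewrite E; split=> _; first exact: positive_dimensional_block.
  rewrite git_pi_conj //; first exact: singular_SL3_GL2.
  by split; apply: SL3_GL2_SL3.
(* Any pair over a singular point is reducible, and degenerates to a block diagonal pair over the
   same point. *)
apply/seteqP; split=> [_ [[x y] [[dx dy] sing] <-]|_ [[x y] [hx hy] <-]].
  have [|x' [y' [hx hy ->]]] := git_pi_reducible dx dy; last by exists (x', y').
  by apply: singular_reducible => //; exists (x, y).
exact: singular_SL3_GL2.
Qed.
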